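(* Let $G=\langle g_1,\dots,g_d\rangle$ be a Kleinian group of Schottky type and let $\Phi_G$ denote the canonical graph directed Markov system associated to $G$. For every non-trivial normal subgroup $N$ of $G$ we have $$L_{\mathrm r}(N)=\Lambda_r(N,\Phi_G)\quad\text{and}\quad L_{\mathrm{ur}}(N)=\Lambda_{ur}(N,\Phi_G).$$
   Context: Let $m\ge1$, $\mathbb{D}^{m+1}=\{z\in\mathbb{R}^{m+1}:|z|<1\}$ with the hyperbolic metric $d(\cdot,\cdot)$, $\mathbb{S}^m=\{z\in\mathbb{R}^{m+1}:|z|=1\}$, and let $\mathrm{Con}(m)$ be the set of orientation preserving conformal automorphisms of $\mathbb{D}^{m+1}$ (extended to $\mathbb{D}^{m+1}\cup\mathbb{S}^m$). Schottky type. Let $d\ge2$ and let $\{D_n^j:n\in\{1,\dots,d\},j\in\{-1,1\}\}$ be pairwise disjoint compact Euclidean balls in $\mathbb{R}^{m+1}$ which intersect $\mathbb{S}^m$ orthogonally, with $\mathrm{diam}(D_n^1)=\mathrm{diam}(D_n^{-1})$. For each $n$ let $g_n\in\mathrm{Con}(m)$ be the hyperbolic element with $g_n(\mathbb{D}^{m+1}\cap\partial D_n^{-1})=\mathbb{D}^{m+1}\cap\partial D_n^1$, namely the hyperbolic translation along the common perpendicular geodesic of these two hyperbolic hyperplanes which maps $\mathbb{D}^{m+1}\setminus D_n^{-1}$ onto the interior of $D_n^1$ in $\mathbb{D}^{m+1}$. Then $G:=\langle g_1,\dots,g_d\rangle$ is the Kleinian group of Schottky type generated by these balls; it is a free group on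 $g_1,\dots,g_d$. Canonical GDMS $\Phi_G$. $V=\{g_1,g_1^{-1},\dots,g_d,g_d^{-1}\}$, $E=\{(v,w)\in V^2:v\ne w^{-1}\}$, $X_{g_n^j}:=(\mathbb{D}^{m+1}\cup\mathbb{S}^m)\cap D_n^j$, and $\phi_{(v,w)}:=v|_{X_w}:X_w\to X_v$ for $(v,w)\in E$. Let $\Sigma_{\Phi_G}$ be the set of sequences $((v_i,w_i))_{i\ge1}\in E^{\mathbb{N}}$ with $w_i=v_{i+1}$ for all $i$. The coding map $\pi_{\Phi_G}$ is given by $\{\pi_{\Phi_G}(\omega)\}=\bigcap_{n\ge1}\phi_{\omega_1}\circ\cdots\circ\phi_{\omega_n}(X_{w_n})$, $\omega_i=(v_i,w_i)$; since the $X_v$ are pairwise disjoint, its values are regarded as points of $\mathbb{R}^{m+1}$. For a subgroup $H$ of $G$, $$\Lambda_r(H,\Phi_G):=\pi_{\Phi_G}\{((v_i,w_i))\in\Sigma_{\Phi_G}:\exists\gamma\in G\text{ with }v_1\cdots v_n\in H\gamma\text{ for infinitely many }n\in\mathbb{N}\},$$ $$\Lambda_{ur}(H,\Phi_G):=\pi_{\Phi_G}\{((v_i,w_i))\in\Sigma_{\Phi_G}:\exists\Gamma\subset G\text{ finite with }v_1\cdots v_n\in H\Gamma\text{ for all }n\in\mathbb{N}\}.$$ Limit sets of Kleinian groups. For a Kleinian group $H$, the limit set $L(H)\subset\mathbb{S}^m$ is the set of accumulation points (Euclidean topology) of the orbit $H(z)$ of any point $z\in\mathbb{D}^{m+1}$.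 For $\xi\in\mathbb{S}^m$ let $s_\xi\subset\mathbb{D}^{m+1}$ be the hyperbolic ray from $0$ to $\xi$, and $B(x,r)$ the open hyperbolic ball of radius $r$ centred at $x$. Then $$L_{\mathrm r}(H):=\{\xi\in L(H):\exists c>0\text{ with }s_\xi\cap B(g(0),c)\ne\emptyset\text{ for infinitely many }g\in H\},$$ $$L_{\mathrm{ur}}(H):=\{\xi\in L(H):\exists c>0\text{ with }s_\xi\subset\bigcup_{g\in H}B(g(0),c)\}.$$ *)

(* Defs.v *)
From HB Require Import structures.
From mathcomp Require Import all_boot all_order all_algebra.
From mathcomp Require Import all_classical all_reals all_analysis.
Set Implicit Arguments.
Unset Strict Implicit.
Unset Printing Implicit Defensive.
Import Order.TTheory GRing.Theory Num.Theory.
Import numFieldNormedType.Exports.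
Local Open Scope classical_set_scope.
Local Open Scope ring_scope.

Section Euclidean.
Context {R : realType} {m : nat}.
Local Notation V := 'rV[R]_m.+1.
Implicit Types (x y a : V) (r : R).

(* The norm of the library on row vectors is the sup norm: it induces the
   right topology, but the Euclidean length has to be defined separately. *)
Definition dot x y : R := \sum_i x ord0 i * y ord0 i.
Definition enorm x : R := Num.sqrt (dot x x).

Definition eball a r : set V := [set x | enorm (x - a) < r].
Definition ecball a r : set V := [set x | enorm (x - a) <= r].
Definition esphere a r : set V := [set x | enorm (x - a) = r].
Definition ediam (A : set V) : R :=
  sup [set t | exists x y, [/\ A x, A y & t = enorm (x - y)]].

Definition Disc : set V := [set x | enorm x < 1].
Definition Sphere : set V := [set x | enorm x = 1].
Definition cDisc : set V := Disc `|` Sphere.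

Definition meets_Sphere_orthogonally a r : Prop :=
  esphere a r `&` Sphere !=set0 /\
  forall x, esphere a r x -> Sphere x -> dot (x - a) x = 0.

End Euclidean.

Section Hyperbolic.
Context {R : realType} {m : nat}.
Local Notation V := 'rV[R]_m.+1.
Implicit Types (x y xi : V) (f : V -> V).

Definition arcosh (t : R) : R := ln (t + Num.sqrt (t ^+ 2 - 1)).

(* The hyperbolic (curvature -1) distance of the Poincare ball model;
   meaningful for points of Disc only. *)
Definition hdist x y : R :=
  arcosh (1 + 2 * enorm (x - y) ^+ 2 /
                ((1 - enorm x ^+ 2) * (1 - enorm y ^+ 2))).

Definition hball x (r : R) : set V := [set y | Disc y /\ hdist x y < r].

Definition geodesic_line (gam : R -> V) : Prop :=
  (forall t, Disc (gam t)) /\ (forall s t, hdist (gam s) (gam t) = `|s - t|).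

Definition geodesic_ray (rho : R -> V) x xi : Prop :=
  [/\ rho 0 = x,
      forall t, 0 <= t -> Disc (rho t),
      forall s t, 0 <= s -> 0 <= t -> hdist (rho s) (rho t) = `|s - t|
    & rho t @[t --> +oo] --> xi].

Definition ray xi : set V :=
  [set x | exists rho t, [/\ geodesic_ray rho 0 xi, 0 <= t & x = rho t]].

(* Hyperbolic hyperplanes are given by pairs P = (a, k) with |a|^2 > k^2, P
   standing for {x in Disc | k (|x|^2 + 1) = 2 <a, x>}.  For k <> 0 this is the
   trace of the Euclidean sphere of centre a / k that is orthogonal to the unit
   sphere; for k = 0 it is the trace of the linear hyperplane orthogonal to a.
   The vector k x - a is normal to P at a point x of P. *)
Definition is_hyperplane (P : V * R) : Prop := P.2 ^+ 2 < dot P.1 P.1.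

Definition hplane_eq (P : V * R) x : R :=
  P.2 * (dot x x + 1) - 2 * dot P.1 x.

Definition hplane (P : V * R) : set V := [set x | Disc x /\ hplane_eq P x = 0].

Definition hnormal (P : V * R) x : V := P.2 *: x - P.1.

(* The reflection in P: the inversion in the sphere of centre a / k if k <> 0,
   and the linear reflection x - 2 <a, x> / |a|^2 a if k = 0. *)
Definition hrefl (P : V * R) x : V :=
  x - (hplane_eq P x / dot (hnormal P x) (hnormal P x)) *: hnormal P x.

(* The metric is conformal to the Euclidean one, so orthogonality can be
   tested with Euclidean normals. *)
Definition perpendicular (gam : R -> V) (P : V * R) : Prop :=
  exists s, [/\ hplane P (gam s), derivable gam s 1
              & exists k : R, 'D_1 gam s = k *: hnormal P (gam s)].

(* Hyperbolic translations along gam are the products of the reflections in two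
   distinct hyperplanes orthogonal to gam. *)
Definition translation_along (gam : R -> V) f : Prop :=
  exists P Q : V * R,
    [/\ is_hyperplane P /\ is_hyperplane Q, hplane P <> hplane Q,
        perpendicular gam P, perpendicular gam Q
      & forall x, cDisc x -> f x = hrefl P (hrefl Q x)].

(* Orientation preserving conformal automorphisms of Disc, extended to the
   closed disc.  They are represented by maps of the whole space that are the
   identity off the closed disc, so that equality of functions is equality of
   maps of the closed disc. *)
Definition Con : set (V -> V) :=
  [set f | [/\ set_bij Disc Disc f /\ set_bij Sphere Sphere f,
               {within cDisc, continuous f},
               forall x, Disc x ->
                 [/\ differentiable f x,
                     exists2 k : R, 0 < k &
                       jacobian f x *m (jacobian f x)^T = k%:M
                   & 0 < \det (jacobian f x)]
             & forall x, ~ cDisc x -> f x = x]].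

End Hyperbolic.

Section Groups.
Context {R : realType} {m : nat}.
Local Notation V := 'rV[R]_m.+1.
Implicit Types (H G N : set (V -> V)) (f : V -> V).

Definition inv_map f : V -> V := 'pinv_(fun=> 0) [set: V] f.

(* Only used for sets of bijections of V (elements of Con). *)
Definition subgroup H : Prop :=
  [/\ H id, forall f h, H f -> H h -> H (f \o h) & forall f, H f -> H (inv_map f)].

Definition generated (A : set (V -> V)) : set (V -> V) := smallest subgroup A.

Definition normal_subgroup N G : Prop :=
  [/\ subgroup N, N `<=` G
    & forall f h, G f -> N h -> N (f \o h \o inv_map f)].

(* The points of the ambient space approached by the orbit of every base point;
   for Kleinian groups the choice of the base point is irrelevant. *)
Definition orbit_of H (z : V) : set V := [set f z | f in H].
Definition limit_set H : set V :=
  [set xi | Sphere xi /\ forall z, Disc z -> limit_point (orbit_of H z) xi].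

Definition radial_limit_set H : set V :=
  [set xi | limit_set H xi /\
     exists2 c : R, 0 < c &
       infinite_set [set f | H f /\ ray xi `&` hball (f 0) c !=set0]].

Definition uniformly_radial_limit_set H : set V :=
  [set xi | limit_set H xi /\
     exists2 c : R, 0 < c & ray xi `<=` \bigcup_(f in H) hball (f 0) c].

End Groups.

Section Schottky.
Context {R : realType} {m d : nat}.
Local Notation V := 'rV[R]_m.+1.

(* (n, true) stands for the exponent j = 1, (n, false) for j = -1. *)
Definition letter : Type := ('I_d * bool)%type.
Definition letter_inv (v : letter) : letter := (v.1, ~~ v.2).

Context (ctr : letter -> V) (rad : letter -> R) (g : 'I_d -> V -> V).

Definition D_ (v : letter) : set V := ecball (ctr v) (rad v).

Definition schottky_balls : Prop :=
  [/\ forall v, 0 < rad v,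
      forall v w, v != w -> D_ v `&` D_ w = set0,
      forall v, meets_Sphere_orthogonally (ctr v) (rad v)
    & forall n, ediam (D_ (n, true)) = ediam (D_ (n, false))].

(* The boundary of D_ v is orthogonal to the unit sphere, so that its trace on
   Disc is the hyperplane with parameters (ctr v, 1). *)
Definition schottky_generator (n : 'I_d) (f : V -> V) : Prop :=
  let vp := (n, true) in
  let vm := (n, false) in
  [/\ Con f,
      f @` (Disc `&` esphere (ctr vm) (rad vm)) =
        Disc `&` esphere (ctr vp) (rad vp),
      f @` (Disc `\` D_ vm) = Disc `&` eball (ctr vp) (rad vp)
    & exists gam, [/\ geodesic_line gam, perpendicular gam (ctr vm, 1),
                      perpendicular gam (ctr vp, 1) & translation_along gam f]].

Definition schottky_type : Prop :=
  schottky_balls /\ forall n, schottky_generator n (g n).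

Definition schottky_group : set (V -> V) := generated (range g).

(* The vertices g_n^j of the system are represented by letters. *)
Definition vertex (v : letter) : V -> V :=
  if v.2 then g v.1 else inv_map (g v.1).

Definition edge (e : letter * letter) : Prop := e.1 <> letter_inv e.2.

Definition X_ (v : letter) : set V := cDisc `&` D_ v.

(* Only applied to points of X_ e.2. *)
Definition phi (e : letter * letter) : V -> V := vertex e.1.

Fixpoint comp_prefix (F : nat -> V -> V) (n : nat) : V -> V :=
  if n is k.+1 then comp_prefix F k \o F k else id.

(* Sequences of edges are indexed from 0. *)
Definition Sigma : set (nat -> letter * letter) :=
  [set om | (forall i, edge (om i)) /\ forall i, (om i).2 = (om i.+1).1].

Definition coded_by (om : nat -> letter * letter) (x : V) : Prop :=
  \bigcap_n (comp_prefix (phi \o om) n.+1 @` X_ (om n).2) = [set x].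

(* The product v_1 ... v_n of the initial vertices of the first n edges. *)
Definition word (om : nat -> letter * letter) (n : nat) : V -> V :=
  comp_prefix (fun i => vertex (om i).1) n.

Definition translates (H Gam : set (V -> V)) : set (V -> V) :=
  [set h \o gam | h in H & gam in Gam].

Definition Lambda_r (H : set (V -> V)) : set V :=
  [set x | exists om, [/\ Sigma om, coded_by om x
     & exists2 gam, schottky_group gam &
         infinite_set [set n | (0 < n)%N /\ translates H [set gam] (word om n)]]].

Definition Lambda_ur (H : set (V -> V)) : set V :=
  [set x | exists om, [/\ Sigma om, coded_by om x
     & exists Gam, [/\ Gam `<=` schottky_group, finite_set Gam
         & forall n, (0 < n)%N -> translates H Gam (word om n)]]].

End Schottky.

(* Main.v *)
Require Import Defs.
From HB Require Import structures.
From mathcomp Require Import all_boot all_order all_algebra.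
From mathcomp Require Import all_classical all_reals all_analysis.
From mathcomp Require Import ring lra.
Import Order.TTheory GRing.Theory Num.Theory.
Import numFieldNormedType.Exports.
Local Open Scope classical_set_scope.
Local Open Scope ring_scope.

(** The generators are products of two hyperbolic reflections, so every element
[f] of the group acts on the closed ball with a conformal factor [lam]:
[|f x - f y|^2 = lam x * lam y * |x - y|^2] and [1 - |f x|^2 = lam x * (1 - |x|^2)]
([conformal_factor], [hrefl_conformal]).  Hence
[sinh2 x y = |x - y|^2 / ((1 - |x|^2) (1 - |y|^2))], the square of the hyperbolic
sine of half the distance, is invariant.  It satisfies a coarse triangle
inequality ([sinh2_triangle]), so that everything below can be phrased through
boundedness of [sinh2].  The ray to [xi] is the Euclidean segment of the points
[t *: xi], [0 <= t < 1] ([ray_segment]).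

The balls are pairwise disjoint and miss the origin.  By ping-pong a non-empty
reduced word sends the origin into the ball of its first letter
([eval_word_first]).  It follows that the orbit of the origin is uniformly
separated, whence only finitely many group elements move the origin by a bounded
amount ([near_elements_finite]), and the prefixes [w_n = v_1 ... v_n] of an
admissible sequence satisfy [|w_n 0| -> 1].

Let [x] lie in all the cylinders of an admissible sequence.  The pole
[w_n^-1 0] lies in the ball of [v_n^-1], and [w_n^-1 x] in the one of [v_(n+1)],
which is a different ball, so these points are far apart and
[|w_n 0 - x| <= C (1 - |w_n 0|^2)] ([cylinder_shadow]).  This estimate has three
consequences.  The cylinders shrink to [x] ([in_cylinders_coded]).  Every
[w_n 0] is within bounded hyperbolic distance of the ray to [x]
([words_near_ray]).  Every point of that ray is within bounded distance of some
[w_n 0], since consecutive [w_n 0] are at bounded distance from each other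
([ray_near_words]).  Conversely, an accumulation point of the orbit of the origin
lies in a ball, and peeling off the corresponding letter gives again an
accumulation point, so limit points are coded ([orbit_limit_coded]).

Now let [N] be a subgroup and [x] be coded.  If [f] in [N] moves the origin to a
point close to [w_n 0], then [w_n = f h] for some [h] among finitely many
group elements; and if [w_n = f h] with [f] in [N], then [f 0] is close to [w_n 0]
in terms of [h].  Together with the two comparisons of the ray with the points
[w_n 0], this turns each radial condition into the corresponding condition on
cosets; for the radial case a pigeonhole over the finitely many [h] is added. *)

Local Notation nsq x := (dot x x).

(** * Euclidean preliminaries *)

Section EuclideanLemmas.
Set Implicit Arguments. Unset Strict Implicit.
Context {R : realType} {m : nat}.
Local Notation V := 'rV[R]_m.+1.
Implicit Types (x y z a : V) (r e : R).

Lemma dotC x y : dot x y = dot y x.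
Proof. by apply: eq_bigr => i _; rewrite mulrC. Qed.

Lemma dotDl x y z : dot (x + y) z = dot x z + dot y z.
Proof. by rewrite -big_split; apply: eq_bigr => i _; rewrite mxE mulrDl. Qed.

Lemma dotZl r x y : dot (r *: x) y = r * dot x y.
Proof. by rewrite mulr_sumr; apply: eq_bigr => i _; rewrite mxE mulrA. Qed.

Lemma dotNl x y : dot (- x) y = - dot x y.
Proof. by rewrite -scaleN1r dotZl mulN1r. Qed.

Lemma dot0l x : dot 0 x = 0.
Proof. by rewrite -(scale0r 0) dotZl mul0r. Qed.

Lemma dotDr x y z : dot x (y + z) = dot x y + dot x z.
Proof. by rewrite dotC dotDl !(dotC x). Qed.

Lemma dotZr r x y : dot x (r *: y) = r * dot x y.
Proof. by rewrite dotC dotZl dotC. Qed.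

Lemma dotNr x y : dot x (- y) = - dot x y.
Proof. by rewrite dotC dotNl dotC. Qed.

Lemma dot0r x : dot x 0 = 0.
Proof. by rewrite dotC dot0l. Qed.

Definition dotE := (dotDl, dotDr, dotNl, dotNr, dotZl, dotZr, dot0l, dot0r).

Lemma nsqN x : nsq (- x) = nsq x.
Proof. by rewrite !dotE opprK. Qed.

Lemma nsqBC x y : nsq (x - y) = nsq (y - x).
Proof. by rewrite -nsqN opprB. Qed.

Lemma nsq_ge0 x : 0 <= nsq x.
Proof. by apply: sumr_ge0 => i _; exact: sqr_ge0. Qed.

Lemma nsq_eq0 x : nsq x = 0 -> x = 0.
Proof.
move=> /eqP; rewrite psumr_eq0; last by move=> i _; exact: sqr_ge0.
move=> /allP x0; apply/rowP => i; rewrite mxE.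
have := x0 i; rewrite mem_index_enum mulf_eq0 orbb => /(_ isT) /eqP <-.
by rewrite (ord1 ord0).
Qed.

Lemma cauchy_schwarz x y : dot x y ^+ 2 <= nsq x * nsq y.
Proof.
have [y0|y0] := eqVneq (nsq y) 0.
  by rewrite (nsq_eq0 y0) !dotE expr0n mulr0.
have y_gt0 : 0 < nsq y by rewrite lt_neqAle eq_sym y0 nsq_ge0.
have := nsq_ge0 (nsq y *: x - dot x y *: y).
rewrite !dotE (dotC y x) => h.
have : 0 <= nsq y * (nsq x * nsq y - dot x y ^+ 2) by lra.
by rewrite pmulr_rge0// subr_ge0.
Qed.

Lemma dot_le1 x y : nsq x <= 1 -> nsq y <= 1 -> `|dot x y| <= 1.
Proof.
move=> x1 y1; rewrite -(ler_pXn2r (_ : 0 < 2)%N) ?nnegrE// expr1n.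
rewrite real_normK ?num_real//; apply: (le_trans (cauchy_schwarz _ _)).
by rewrite mulr_ile1 ?nsq_ge0.
Qed.

Lemma nsqD_le x y : nsq (x + y) <= 2 * nsq x + 2 * nsq y.
Proof. by have := nsq_ge0 (x - y); rewrite !dotE (dotC y x); lra. Qed.

Lemma nsqB_le x y z : nsq (x - z) <= 2 * nsq (x - y) + 2 * nsq (y - z).
Proof. by rewrite -(subrKA y) nsqD_le. Qed.

Lemma enorm_ge0 x : 0 <= enorm x.
Proof. exact: sqrtr_ge0. Qed.

Lemma enorm_sqr x : enorm x ^+ 2 = nsq x.
Proof. by rewrite sqr_sqrtr ?nsq_ge0. Qed.

Lemma enorm_le x r : 0 <= r -> (enorm x <= r) = (nsq x <= r ^+ 2).
Proof.
by move=> r0; rewrite -(ler_pXn2r (_ : 0 < 2)%N) ?nnegrE ?enorm_ge0// enorm_sqr.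
Qed.

Lemma enorm_lt x r : 0 <= r -> (enorm x < r) = (nsq x < r ^+ 2).
Proof.
by move=> r0; rewrite -(ltr_pXn2r (_ : 0 < 2)%N) ?nnegrE ?enorm_ge0// enorm_sqr.
Qed.

Lemma enormD x y : enorm (x + y) <= enorm x + enorm y.
Proof.
rewrite enorm_le ?addr_ge0 ?enorm_ge0// sqrrD !enorm_sqr !dotE (dotC y x).
suff : dot x y <= enorm x * enorm y by lra.
apply: le_trans (ler_norm _) _.
rewrite -(ler_pXn2r (_ : 0 < 2)%N) ?nnegrE ?mulr_ge0 ?enorm_ge0//.
by rewrite real_normK ?num_real// exprMn !enorm_sqr cauchy_schwarz.
Qed.

Lemma enormBC x y : enorm (x - y) = enorm (y - x).
Proof. by rewrite /enorm nsqBC. Qed.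

Lemma enormZ r x : enorm (r *: x) = `|r| * enorm x.
Proof.
by rewrite /enorm !dotE mulrA -expr2 sqrtrM ?sqr_ge0// sqrtr_sqr.
Qed.

Lemma DiscE x : Disc x <-> nsq x < 1.
Proof. by rewrite /Disc /= enorm_lt// expr1n. Qed.

Lemma SphereE x : Sphere x <-> nsq x = 1.
Proof.
rewrite /Sphere /= -enorm_sqr; split => [->|]; first by rewrite expr1n.
move=> /eqP; rewrite sqrf_eq1 => /orP[/eqP//|/eqP h].
by have := enorm_ge0 x; rewrite h; lra.
Qed.

Lemma cDiscE x : cDisc x <-> nsq x <= 1.
Proof.
split; first by move=> [/DiscE/ltW//|/SphereE ->].
by rewrite le_eqVlt => /orP[/eqP/SphereE|/DiscE]; [right|left].
Qed.

Lemma cDisc_subr_ge0 x : cDisc x -> 0 <= 1 - nsq x.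
Proof. by move=> /cDiscE; rewrite subr_ge0. Qed.

Lemma Disc_subr_gt0 x : Disc x -> 0 < 1 - nsq x.
Proof. by move=> /DiscE; rewrite subr_gt0. Qed.

Lemma cDisc0 : cDisc (0 : V).
Proof. by apply/cDiscE; rewrite dot0l ler01. Qed.

Lemma Disc0 : Disc (0 : V).
Proof. by apply/DiscE; rewrite dot0l ltr01. Qed.

Lemma sumr_ordV e : \sum_(i < m.+1) (e / m.+1%:R) = e.
Proof. by rewrite sumr_const card_ord -[LHS]mulr_natr mulfVK// pnatr_eq0. Qed.

(** The topology of row vectors comes from the sup norm, which is equivalent to the
Euclidean one. *)
Lemma nbhs_nsq x (U : set V) :
  nbhs x U <-> exists2 e, 0 < e & forall y, nsq (y - x) < e -> U y.
Proof.
split.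
  move=> /nbhs_ballP[e /= e0 xU]; exists (e ^+ 2); first by rewrite exprn_gt0.
  move=> y yx; apply: xU; split => // i j; rewrite (ord1 i).
  rewrite -ball_normE/= -(ltr_pXn2r (_ : 0 < 2)%N) ?nnegrE ?(ltW e0)//.
  rewrite real_normK ?num_real//; apply: le_lt_trans yx.
  rewrite nsqBC /dot (bigD1 j)//= !mxE expr2 lerDl.
  by apply: sumr_ge0 => k _; exact: sqr_ge0.
move=> [e e0 xU]; apply/nbhs_ballP.
have e'0 : 0 < e / m.+1%:R by rewrite divr_gt0.
exists (Num.sqrt (e / m.+1%:R)); first by rewrite /= sqrtr_gt0.
move=> y [_ /(_ ord0) xy]; apply: xU; rewrite nsqBC.
rewrite -(sumr_ordV e).
apply: ltr_sum; first by apply/hasP; exists ord0 => //; rewrite mem_index_enum.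
move=> i _; have := xy i; rewrite -ball_normE/= => h.
rewrite !mxE -expr2 -(sqr_sqrtr (ltW e'0)).
by rewrite -(real_normK (num_real (_ - _))) ltr_pXn2r ?nnegrE ?sqrtr_ge0.
Qed.

Lemma nsq_small_eq x y : (forall e, 0 < e -> nsq (x - y) < e) -> x = y.
Proof.
move=> h; apply/eqP; rewrite -subr_eq0; apply/eqP/nsq_eq0/eqP.
rewrite eq_le nsq_ge0 andbT leNgt; apply/negP => /h; by rewrite ltxx.
Qed.

(** Two closed balls without common point lie at a positive distance: otherwise
the segment between their centres meets both. *)
Lemma disjoint_ecballs a b r s : 0 < r -> 0 < s ->
  ecball a r `&` ecball b s = set0 :> set V ->
  exists2 e, 0 < e &
    forall x y, ecball a r x -> ecball b s y -> e <= nsq (x - y).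
Proof.
move=> r0 s0 disj.
have h : r + s < enorm (a - b).
  rewrite ltNge; apply/negP => le.
  suff : set0 (a + (r / (r + s)) *: (b - a)) by [].
  have rs : 0 < r + s by rewrite addr_gt0.
  have r_ge0 : 0 <= r / (r + s) by rewrite divr_ge0// ltW.
  have s_ge0 : 0 <= s / (r + s) by rewrite divr_ge0// ltW.
  rewrite -disj; split; rewrite /ecball /=.
    rewrite addrC addKr enormZ ger0_norm//.
    by rewrite mulrAC ler_pdivrMr// ler_pM2l// enormBC.
  rewrite (_ : _ - b = (s / (r + s)) *: (a - b)); last first.
    apply/rowP => i; rewrite !mxE; field; lra.
  rewrite enormZ ger0_norm//.
  by rewrite mulrAC ler_pdivrMr// ler_pM2l.
exists ((enorm (a - b) - r - s) ^+ 2); first by apply: exprn_gt0; lra.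
move=> x y; rewrite /ecball /= => xa yb; rewrite -enorm_sqr.
rewrite ler_pXn2r ?nnegrE ?enorm_ge0//; last by lra.
have := enormD (a - x) (x - b); rewrite subrKA => h1.
have := enormD (x - y) (y - b); rewrite subrKA => h2.
rewrite enormBC in xa; lra.
Qed.

Lemma ecball_closed a r x :
  (forall e, 0 < e -> exists2 y, ecball a r y & nsq (x - y) < e) -> ecball a r x.
Proof.
move=> h; rewrite /ecball /= leNgt; apply/negP => lt.
have d0 : 0 < enorm (x - a) - r by lra.
have [|y ya xy] := h ((enorm (x - a) - r) ^+ 2); first by rewrite exprn_gt0.
move: xy; rewrite -enorm_lt; last exact: ltW.
rewrite /ecball /= in ya.
by have := enormD (x - y) (y - a); rewrite subrKA => h1; lra.
Qed.

(** A bounded family of points at mutual distances bounded below is finite: a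
fine enough cubical grid has at most one of these points in each cell. *)
Lemma separated_finite (T : Type) (A : set T) (f : T -> V) e : 0 < e ->
  (forall t, A t -> nsq (f t) <= 1) ->
  (forall s t, A s -> A t -> s <> t -> e <= nsq (f s - f t)) ->
  finite_set A.
Proof.
move=> e0 bnd sep.
(* cells of side [s] with [(m + 1) s^2 = e] have square diameter [e] *)
pose q : R := e / m.+1%:R; have q0 : 0 < q by rewrite divr_gt0.
pose s := Num.sqrt q; have s0 : 0 < s by rewrite sqrtr_gt0.
pose K := Num.truncn (2 / s).
pose cell t : {ffun 'I_m.+1 -> 'I_K.+1} :=
  [ffun i => inord (Num.truncn ((f t ord0 i + 1) / s))].
have coord t i : A t -> 0 <= f t ord0 i + 1 <= 2.
  move=> At; suff : `|f t ord0 i| <= 1 by rewrite ler_norml; lra.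
  rewrite -(ler_pXn2r (_ : 0 < 2)%N) ?nnegrE// expr1n real_normK ?num_real//.
  apply: le_trans (bnd _ At); rewrite /dot (bigD1 i)//= expr2 lerDl.
  by apply: sumr_ge0 => k _; exact: sqr_ge0.
have cellE t i : A t -> cell t i = Num.truncn ((f t ord0 i + 1) / s) :> nat.
  move=> At; have /andP[c1 c2] := coord t i At.
  rewrite ffunE inordK// ltnS; apply: le_truncn.
  by rewrite ler_pM2r ?invr_gt0.
have injc : {in A &, injective cell}.
  move=> t u; rewrite !inE => At Au tu; apply: contrapT => ntu.
  suff : nsq (f t - f u) < e by have := sep _ _ At Au ntu; lra.
  rewrite -(sumr_ordV e) -/q.
  apply: ltr_sum; first by apply/hasP; exists ord0 => //; rewrite mem_index_enum.
  move=> i _; rewrite !mxE -expr2 -(sqr_sqrtr (ltW q0)) -/s.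
  have /andP[t1 _] := coord t i At; have /andP[u1 _] := coord u i Au.
  have := truncn_itv (divr_ge0 t1 (ltW s0)); have := truncn_itv (divr_ge0 u1 (ltW s0)).
  rewrite -!cellE// tu -natr1 !ler_pdivlMr// !ltr_pdivrMr//.
  move=> /andP[a1 a2] /andP[a3 a4].
  rewrite -(real_normK (num_real (_ - _))) ltr_pXn2r ?nnegrE ?(ltW s0)// ltr_norml.
  lra.
by rewrite -(eq_finite_set (inj_card_eq injc)); exact: finite_finset.
Qed.

End EuclideanLemmas.

(** * Moebius maps of the closed ball *)

Section Moebius.
Set Implicit Arguments. Unset Strict Implicit.
Context {R : realType} {m : nat}.
Local Notation V := 'rV[R]_m.+1.
Implicit Types (x y z p a : V) (f h : V -> V) (lam mu : V -> R).

(** These identities characterize the Moebius maps preserving the ball; [lam x] is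
the norm of the derivative of [f] at [x]. *)
Definition conformal_factor f lam : Prop :=
  forall x, cDisc x ->
    [/\ 0 < lam x, 1 - nsq (f x) = lam x * (1 - nsq x)
      & forall y, cDisc y -> nsq (f x - f y) = lam x * lam y * nsq (x - y)].

(** Bijectivity is required on the whole space, where elements of [Con] are
inverted. *)
Definition moebius f : Prop :=
  [/\ bijective f, forall x, cDisc (f x) <-> cDisc x
    & exists lam, conformal_factor f lam].

Lemma conformal_factor_cDisc f lam x :
  conformal_factor f lam -> cDisc x -> cDisc (f x).
Proof.
move=> fl xD; have [l0 fx _] := fl x xD; apply/cDiscE; rewrite -subr_ge0 fx.
by apply: mulr_ge0; [exact: ltW|exact: cDisc_subr_ge0].
Qed.

Lemma conformal_factor_comp f h lam mu :
  conformal_factor f lam -> conformal_factor h mu ->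
  conformal_factor (f \o h) (fun x => lam (h x) * mu x).
Proof.
move=> fl hm x xD; have hxD := conformal_factor_cDisc hm xD.
have [m0 hx hxy] := hm x xD; have [l0 fx fxy] := fl _ hxD.
split => /=; [exact: mulr_gt0|by rewrite fx hx mulrA|move=> y yD].
rewrite fxy; last exact: conformal_factor_cDisc hm yD.
by rewrite hxy//; ring.
Qed.

Lemma moebius_id : moebius id.
Proof.
split; [by exists id|by []|exists (fun=> 1) => x _].
by split => [||y _]; rewrite ?ltr01 ?mul1r.
Qed.

Lemma moebius_comp f h : moebius f -> moebius h -> moebius (f \o h).
Proof.
move=> [fb fD [lam fl]] [hb hD [mu hm]]; split; first exact: bij_comp.
- by move=> x; rewrite /= fD.
- by exists (fun x => lam (h x) * mu x); exact: conformal_factor_comp.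
Qed.

Lemma moebius_inverse f h : moebius f -> cancel f h -> cancel h f -> moebius h.
Proof.
move=> [fb fD [lam fl]] fK hK; have hD x : cDisc (h x) <-> cDisc x.
  by rewrite -{2}(hK x) fD.
split; [by exists f|by []|exists (fun x => (lam (h x))^-1)].
move=> x /hD xD; have [l0 fx fxy] := fl _ xD; rewrite hK in fx fxy.
split; first by rewrite invr_gt0.
  by rewrite fx mulKf ?gt_eqF.
move=> y /hD yD; have [k0 _ _] := fl _ yD.
by have := fxy _ yD; rewrite hK => ->; field; rewrite !gt_eqF.
Qed.

Lemma moebius_Disc f x : moebius f -> Disc (f x) <-> Disc x.
Proof.
move=> [_ fD [lam fl]]; have [xD|nxD] := pselect (cDisc x).
  by have [l0 fx _] := fl x xD; rewrite !DiscE -(subr_gt0 (nsq (f x))) -(subr_gt0 (nsq x)) fx pmulr_rgt0.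
by split => ?; case: nxD; [apply/fD; left|left].
Qed.

(** The sum in the right-hand side is [1 - 2 <x, p> + |x|^2 |p|^2], which is at
least [(1 - <x, p>)^2], and [1 - |p|^2 <= 1 - <x, p>^2 <= 2 (1 - <x, p>)]. *)
Lemma bracket_ge x p : nsq x <= 1 -> nsq p <= 1 ->
  (1 - nsq p) ^+ 2 <= 4 * (nsq (x - p) + (1 - nsq x) * (1 - nsq p)).
Proof.
move=> x1 p1; rewrite !dotE (dotC p x).
have := cauchy_schwarz x p; have /ler_normlP[] := dot_le1 x1 p1.
have := nsq_ge0 x; have := nsq_ge0 p; move: (nsq x) (nsq p) (dot x p) x1 p1.
move=> A P b A1 P1 P0 A0 b1 b2 bAP.
have Pb : 1 - P <= 2 * (1 - b).
  have : A * P <= P by rewrite ler_piMl.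
  have : 0 <= (1 - b) ^+ 2 by exact: sqr_ge0.
  lra.
have : (1 - P) ^+ 2 <= (2 * (1 - b)) ^+ 2.
  by rewrite ler_pXn2r ?nnegrE//; lra.
lra.
Qed.

(** Compare [f x] with [f p = 0]: the two identities add up to
[|f x|^2 + (1 - |f x|^2) = 1].  This determines [lam] from the pole [p]. *)
Lemma conformal_factor_pole f lam p x :
  conformal_factor f lam -> cDisc x -> Disc p -> f p = 0 ->
  lam x * (nsq (x - p) + (1 - nsq x) * (1 - nsq p)) = 1 - nsq p.
Proof.
move=> fl xD pD fp0; have pD' : cDisc p by left.
have [l0 fx fxy] := fl x xD; have [k0 fp _] := fl p pD'.
have := fxy p pD'; rewrite fp0 subr0 => e2.
rewrite fp0 dot0l subr0 in fp.
apply: (mulfI (lt0r_neq0 k0)).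
have -> : lam p * (lam x * (nsq (x - p) + (1 - nsq x) * (1 - nsq p))) =
  lam x * lam p * nsq (x - p) + lam x * (1 - nsq x) * (lam p * (1 - nsq p)).
  by ring.
by rewrite -e2 -fx -fp mulr1 addrC subrK.
Qed.

Lemma moebius_pole f : moebius f -> exists2 p, Disc p & f p = 0.
Proof.
move=> fM; have [[h fK hK] _ _] := fM; exists (h 0) => //.
by apply/(moebius_Disc _ fM); rewrite hK; exact: Disc0.
Qed.

(** The conformal factor is bounded on the closed ball because the pole stays away
from the sphere. *)
Lemma moebius_lipschitz f : moebius f -> exists2 L, 0 < L &
  forall x y, cDisc x -> cDisc y -> nsq (f x - f y) <= L * nsq (x - y).
Proof.
move=> fM; have [p pD fp0] := moebius_pole fM.
have [_ _ [lam fl]] := fM.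
have p0 : 0 < 1 - nsq p by exact: Disc_subr_gt0.
have bnd x : cDisc x -> lam x <= 4 / (1 - nsq p).
  move=> xD; rewrite ler_pdivlMr// -(ler_pM2r p0) -mulrA -expr2.
  rewrite -[in leRHS](conformal_factor_pole fl xD pD fp0).
  have [l0 _ _] := fl x xD; rewrite (mulrCA 4) ler_pM2l//.
  by apply: bracket_ge; [apply/cDiscE|rewrite -subr_ge0 ltW].
exists ((4 / (1 - nsq p)) ^+ 2); first by rewrite exprn_gt0// divr_gt0.
move=> x y xD yD; have [l0 _ ->//] := fl x xD; have [k0 _ _] := fl y yD.
by rewrite ler_wpM2r ?nsq_ge0// expr2 ler_pM ?bnd// ltW.
Qed.

(** Everything away from the pole [p] is sent close to the image of the origin, at
the scale [1 - |f 0|^2]: the factor at [x] is at most the factor at the origin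
divided by [|x - p|^2]. *)
Lemma moebius_shadow f p x : moebius f -> cDisc x -> Disc p -> f p = 0 ->
  nsq (f 0 - f x) * nsq (x - p) <= (1 - nsq (f 0)) ^+ 2.
Proof.
move=> [_ _ [lam fl]] xD pD fp0; have pD' : cDisc p by left.
have [l0 f0 f0y] := fl 0 cDisc0; have [lx fx fxy] := fl x xD.
have [lp fp _] := fl p pD'.
have x1 : nsq x <= 1 by apply/cDiscE.
have e1 := f0y p pD'; have e2 := fxy p pD'.
rewrite fp0 subr0 sub0r nsqN in e1; rewrite fp0 subr0 in e2.
rewrite fp0 dot0l subr0 in fp; rewrite dot0l subr0 mulr1 in f0.
rewrite (f0y x xD) sub0r nsqN.
(* the factors at the origin and at the pole are inverse to each other *)
have e3 : lam 0 * lam p = 1 by move: e1 f0 fp; nra.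
have h : lam p * (lam x * nsq (x - p)) <= 1.
  have : nsq (f x) <= 1.
    rewrite -subr_ge0 fx; apply: mulr_ge0; first exact: ltW.
    exact: cDisc_subr_ge0.
  by rewrite e2; lra.
have h2 : lam x * nsq (x - p) <= lam 0.
  by rewrite -(ler_pM2l lp) (mulrC _ (lam 0)) e3.
rewrite f0 expr2.
have -> : lam 0 * lam x * nsq x * nsq (x - p) =
  lam 0 * (lam x * nsq (x - p) * nsq x) by ring.
rewrite ler_pM2l//; apply: le_trans h2.
by rewrite ler_piMr// mulr_ge0 ?nsq_ge0// ltW.
Qed.

(** With [nu x = |k x - a|^2], the reflection has conformal factor
[(|a|^2 - k^2) / nu x]; [nu] has no zero on the closed ball since [k^2 < |a|^2]. *)
Lemma hrefl_conformal (P : V * R) : is_hyperplane P ->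
  exists lam, conformal_factor (hrefl P) lam.
Proof.
case: P => a k; rewrite /is_hyperplane /= => ka.
have ka0 : 0 < nsq a - k ^+ 2 by rewrite subr_gt0.
have nu_gt0 x : cDisc x -> 0 < nsq (k *: x - a).
  move=> /cDiscE x1; rewrite lt_neqAle nsq_ge0 andbT eq_sym.
  apply/eqP => /nsq_eq0/eqP; rewrite subr_eq0 => /eqP e.
  move: ka; rewrite -e !dotE ltNge mulrA -expr2 => /negP; apply.
  by rewrite ler_piMr ?sqr_ge0.
exists (fun x => (nsq a - k ^+ 2) / nsq (k *: x - a)) => x xD.
split; first by rewrite divr_gt0 ?nu_gt0.
  have := nu_gt0 x xD; rewrite /hrefl /hplane_eq /hnormal /= !dotE (dotC x a).
  by move=> h; field; rewrite gt_eqF.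
move=> y yD; have := nu_gt0 x xD; have := nu_gt0 y yD.
rewrite /hrefl /hplane_eq /hnormal /= !dotE.
rewrite !(dotC _ a) (dotC y x) => h h'; field; apply/andP; split; rewrite gt_eqF//.
Qed.

(** The formula with two reflections gives the conformal factor, and [Con] the
bijectivity: the pieces on the open ball, the sphere and the exterior do not
overlap. *)
Lemma translation_moebius gam f : Con f -> translation_along gam f -> moebius f.
Proof.
move=> [[[fD Dinj Dsur] [fS Sinj Ssur]] _ _ fout] [P [Q [[hP hQ] _ _ _ fPQ]]].
have fcD x : cDisc x -> cDisc (f x).
  by move=> [xD|xS]; [left; apply: fD|right; apply: fS].
have fcDE x : cDisc (f x) <-> cDisc x.
  by split => [|/fcD//]; apply: contraPP => nx; rewrite fout.
have DS x : Disc x -> Sphere x -> False.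
  by move=> /DiscE x1 /SphereE x2; rewrite x2 ltxx in x1.
have finj : injective f.
  move=> x y fxy.
  have [xD|nx] := pselect (cDisc x); last first.
    have ny : ~ cDisc y by rewrite -fcDE -fxy fcDE.
    by rewrite fout// fout in fxy.
  have yD : cDisc y by rewrite -fcDE -fxy fcDE.
  case: xD => xD; case: yD => yD.
  - by apply: Dinj; rewrite ?inE.
  - by have := DS _ (fD _ xD); rewrite fxy => /(_ (fS _ yD)).
  - by have := DS _ (fD _ yD); rewrite -fxy => /(_ (fS _ xD)).
  - by apply: Sinj; rewrite ?inE.
have fsur y : exists x, f x = y.
  have [[yD|yS]|ny] := pselect (cDisc y); last by exists y; rewrite fout.
    by have [x _ <-] := Dsur y yD; exists x.
  by have [x _ <-] := Ssur y yS; exists x.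
split => //.
  have [h hK] := choice fsur; exists h => // x.
  by apply: finj; rewrite hK.
have [lam Pl] := hrefl_conformal hP; have [mu Qm] := hrefl_conformal hQ.
exists (fun x => lam (hrefl Q x) * mu x) => x xD.
have [l0 e1 e2] := conformal_factor_comp Pl Qm xD.
by split => // [|y yD]; rewrite !fPQ// e2.
Qed.

End Moebius.

(** * Hyperbolic distances and rays *)

Section Hyperbolic.
Set Implicit Arguments. Unset Strict Implicit.
Context {R : realType} {m : nat}.
Local Notation V := 'rV[R]_m.+1.
Implicit Types (x y z xi : V) (f : V -> V) (r s t u e : R).

(** The square of [sinh (d (x, y) / 2)], with [d] the hyperbolic distance. *)
Definition sinh2 x y : R := nsq (x - y) / ((1 - nsq x) * (1 - nsq y)).

Lemma sinh2C x y : sinh2 x y = sinh2 y x.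
Proof. by rewrite /sinh2 nsqBC (mulrC (1 - nsq x)). Qed.

Lemma sinh2_ge0 x y : Disc x -> Disc y -> 0 <= sinh2 x y.
Proof.
move=> /Disc_subr_gt0 x1 /Disc_subr_gt0 y1.
by rewrite divr_ge0 ?nsq_ge0// mulr_ge0// ltW.
Qed.

Lemma sinh2_nsq x y : Disc x -> Disc y ->
  nsq (x - y) = sinh2 x y * ((1 - nsq x) * (1 - nsq y)).
Proof.
move=> /Disc_subr_gt0 x1 /Disc_subr_gt0 y1.
by rewrite divfK// mulf_neq0// gt_eqF.
Qed.

Lemma sinh2_moebius f x y : moebius f -> Disc x -> Disc y ->
  sinh2 (f x) (f y) = sinh2 x y.
Proof.
move=> [_ _ [lam fl]] xD yD.
have [l0 fx fxy] := fl x (or_introl xD); have [k0 fy _] := fl y (or_introl yD).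
rewrite /sinh2 fxy; last by left.
rewrite fx fy; have := Disc_subr_gt0 xD; have := Disc_subr_gt0 yD => y1 x1.
by field; rewrite !gt_eqF.
Qed.

(** Points at bounded hyperbolic distance lie at comparable Euclidean distances from
the sphere. *)
Lemma depth_le x y : Disc x -> Disc y ->
  1 - nsq x <= 4 * (1 + sinh2 x y) * (1 - nsq y).
Proof.
move=> xD yD; have x1 := Disc_subr_gt0 xD; have y1 := Disc_subr_gt0 yD.
rewrite -(ler_pM2l x1) -expr2.
have -> : (1 - nsq x) * (4 * (1 + sinh2 x y) * (1 - nsq y)) =
  4 * (nsq (y - x) + (1 - nsq y) * (1 - nsq x)).
  by rewrite (nsqBC y) (sinh2_nsq xD yD); ring.
by apply: bracket_ge; rewrite -subr_ge0 ltW.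
Qed.

(** A coarse substitute for the triangle inequality, enough to compose bounds on
hyperbolic distances: it comes from [|x - z|^2 <= 2 |x - y|^2 + 2 |y - z|^2], with
[1 - |y|^2] compared to [1 - |x|^2] and [1 - |z|^2]. *)
Lemma sinh2_triangle x y z : Disc x -> Disc y -> Disc z ->
  sinh2 x z <= 8 * sinh2 x y * (1 + sinh2 y z) + 8 * sinh2 y z * (1 + sinh2 x y).
Proof.
move=> xD yD zD; have x1 := Disc_subr_gt0 xD; have z1 := Disc_subr_gt0 zD.
have yx := depth_le yD xD; have yz := depth_le yD zD.
have x0 := ltW x1; have z0 := ltW z1.
have xy0 := sinh2_ge0 xD yD; have yz0 := sinh2_ge0 yD zD.
rewrite ler_pdivrMr ?mulr_gt0//; apply: le_trans (nsqB_le _ y _) _.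
rewrite (sinh2_nsq xD yD) (sinh2_nsq yD zD) [leRHS]mulrDl.
rewrite (sinh2C y x) in yx.
apply: lerD.
  have -> : 2 * (sinh2 x y * ((1 - nsq x) * (1 - nsq y))) =
    2 * sinh2 x y * (1 - nsq x) * (1 - nsq y) by ring.
  have -> : 8 * sinh2 x y * (1 + sinh2 y z) * ((1 - nsq x) * (1 - nsq z)) =
    2 * sinh2 x y * (1 - nsq x) * (4 * (1 + sinh2 y z) * (1 - nsq z)) by ring.
  by apply: ler_wpM2l => //; apply: mulr_ge0 => //; apply: mulr_ge0.
have -> : 2 * (sinh2 y z * ((1 - nsq y) * (1 - nsq z))) =
  2 * sinh2 y z * (1 - nsq z) * (1 - nsq y) by ring.
have -> : 8 * sinh2 y z * (1 + sinh2 x y) * ((1 - nsq x) * (1 - nsq z)) =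
  2 * sinh2 y z * (1 - nsq z) * (4 * (1 + sinh2 x y) * (1 - nsq x)) by ring.
by apply: ler_wpM2l => //; apply: mulr_ge0 => //; apply: mulr_ge0.
Qed.

Definition triangle_bound K L : R := 8 * K * (1 + L) + 8 * L * (1 + K).

Lemma triangle_bound_ge0 K L : 0 <= K -> 0 <= L -> 0 <= triangle_bound K L.
Proof.
by move=> K0 L0; apply: addr_ge0; apply: mulr_ge0; rewrite ?addr_ge0 ?mulr_ge0.
Qed.

Lemma sinh2_triangle_le x y z K L : Disc x -> Disc y -> Disc z ->
  sinh2 x y <= K -> sinh2 y z <= L ->
  sinh2 x z <= triangle_bound K L.
Proof.
move=> xD yD zD xyK yzL; apply: le_trans (sinh2_triangle xD yD zD) _.
have := sinh2_ge0 xD yD; have := sinh2_ge0 yD zD.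
move: (sinh2 x y) (sinh2 y z) xyK yzL => a b aK bL b0 a0.
have : a * b <= K * L by exact: ler_pM.
rewrite /triangle_bound; lra.
Qed.

Lemma hdistE x y : hdist x y = arcosh (1 + 2 * sinh2 x y).
Proof. by rewrite /hdist !enorm_sqr mulrA. Qed.

Lemma hdist_lt_sinh2 x y r : Disc x -> Disc y ->
  hdist x y < r -> sinh2 x y <= expR r.
Proof.
move=> xD yD; rewrite hdistE /arcosh; have := sinh2_ge0 xD yD.
set s := sinh2 x y => s0 h.
have q0 := sqrtr_ge0 ((1 + 2 * s) ^+ 2 - 1).
have : expR (ln (1 + 2 * s + Num.sqrt ((1 + 2 * s) ^+ 2 - 1))) < expR r.
  by rewrite ltr_expR.
rewrite lnK; last by rewrite posrE; lra.
by lra.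
Qed.

Lemma sinh2_le_hdist K : 0 <= K -> exists2 r, 0 < r &
  forall x y, Disc x -> Disc y -> sinh2 x y <= K -> hdist x y < r.
Proof.
move=> K0; exists (2 * (1 + 2 * K)); first by lra.
move=> x y xD yD; rewrite hdistE /arcosh; have := sinh2_ge0 xD yD.
set s := sinh2 x y => s0 sK.
have t1 : 1 <= 1 + 2 * s by lra.
have q : Num.sqrt ((1 + 2 * s) ^+ 2 - 1) <= 1 + 2 * s.
  rewrite -[leRHS](ger0_norm (le_trans ler01 t1)) -sqrtr_sqr ler_wsqrtr//.
  lra.
have q0 := sqrtr_ge0 ((1 + 2 * s) ^+ 2 - 1).
apply: lt_le_trans (_ : 1 + 2 * s + Num.sqrt ((1 + 2 * s) ^+ 2 - 1) <= _).
  rewrite -[ltRHS]lnK; last by rewrite posrE; lra.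
  by apply: lt_le_trans (expR_ge1Dx _); lra.
by lra.
Qed.

(** With [T = 1 + 2 sinh2 x y], both sides say that [T] is the hyperbolic cosine of
[u]; the right one is rational in [expR u]. *)
Lemma hdist_expR x y u : Disc x -> Disc y -> 0 <= u ->
  hdist x y = u <-> 4 * sinh2 x y * expR u = (expR u - 1) ^+ 2.
Proof.
move=> xD yD u0; rewrite hdistE /arcosh; have := sinh2_ge0 xD yD.
set s := sinh2 x y; set T := 1 + 2 * s => s0.
have E1 : 1 <= expR u by have := expR_ge1Dx u; lra.
have T1 : 0 <= T ^+ 2 - 1 by rewrite /T; nra.
have Q0 := sqrtr_ge0 (T ^+ 2 - 1); have Q2 := sqr_sqrtr T1.
set Q := Num.sqrt _ in Q0 Q2 *; have T0 : 0 < T + Q by rewrite /T; lra.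
split.
  move=> TQ; have : T + Q = expR u by rewrite -TQ lnK ?posrE.
  rewrite /T in Q2 *; move=> e; have {}e : Q = expR u - (1 + 2 * s) by lra.
  by move: Q2; rewrite e; lra.
move=> e; rewrite -(expRK u); congr ln.
have TE : T = (expR u + (expR u)^-1) / 2.
  have E0 : expR u != 0 by rewrite gt_eqF ?expR_gt0.
  apply: (mulfI E0); rewrite [RHS](_ : _ = (expR u ^+ 2 + 1) / 2); last by field.
  by rewrite /T; lra.
have V1 : (expR u)^-1 <= 1 by rewrite invf_le1 ?expR_gt0.
have QE : Q ^+ 2 = ((expR u - (expR u)^-1) / 2) ^+ 2.
  rewrite Q2 TE; field; by rewrite gt_eqF ?expR_gt0.
have : Q = (expR u - (expR u)^-1) / 2.
  apply/eqP; move/eqP: QE; rewrite eqrXn2//; lra.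
by rewrite TE => ->; lra.
Qed.

(** [tanh (t / 2)], the Euclidean distance from the origin of the points at
hyperbolic distance [t] from it. *)
Definition tanh_half t : R := (expR t - 1) / (expR t + 1).

Lemma tanh_half_itv t : 0 <= t -> 0 <= tanh_half t < 1.
Proof.
move=> t0; have E1 : 1 <= expR t by have := expR_ge1Dx t; lra.
by rewrite divr_ge0 ?ltr_pdivrMr; lra.
Qed.

Lemma tanh_half_depth t : 1 - tanh_half t ^+ 2 = 4 * expR t / (expR t + 1) ^+ 2.
Proof. by have := expR_gt0 t => E0; rewrite /tanh_half; field; rewrite gt_eqF//; lra. Qed.

Lemma tanh_half_near1 e : 0 < e -> \forall t \near +oo, (1 - tanh_half t) ^+ 2 < e.
Proof.
move=> e0; near=> t.
have t0 : 0 < t by near: t; exact: nbhs_pinfty_gt.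
have te : 2 / e < t by near: t; apply: nbhs_pinfty_gt; rewrite num_real.
have := expR_ge1Dx t; move=> Et.
have -> : 1 - tanh_half t = 2 / (expR t + 1) by rewrite /tanh_half; field; rewrite gt_eqF//; lra.
have q1 : 2 / (expR t + 1) <= 1 by rewrite ler_pdivrMr; lra.
have q2 : 2 / (expR t + 1) < e.
  by rewrite ltr_pdivrMr; [rewrite ltr_pdivrMr// in te; nra|lra].
have q0 : 0 <= 2 / (expR t + 1) by rewrite divr_ge0//; lra.
by rewrite expr2; nra.
Unshelve. all: by end_near. Qed.

Lemma sphere_point_geodesic xi : Sphere xi ->
  geodesic_ray (fun t => tanh_half t *: xi) 0 xi.
Proof.
move=> /SphereE xi1.
have thD t : 0 <= t -> Disc (tanh_half t *: xi).
  move=> /tanh_half_itv /andP[h0 h1]; apply/DiscE.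
  by rewrite !dotE xi1 mulr1 mulr_ilt1.
split => //.
- by rewrite /tanh_half expR0 subrr mul0r scale0r.
- move=> s t; wlog st : s t / s <= t => [h s0 t0|s0 t0].
    have [/h->//|/ltW ts] := leP s t.
    by rewrite hdistE sinh2C -hdistE h// distrC.
  rewrite ler0_norm ?subr_le0// opprB.
  apply/hdist_expR; rewrite ?subr_ge0//; [exact: thD|exact: thD|].
  rewrite /sinh2 !dotE xi1 !mulr1 -!expr2 !tanh_half_depth expRB /tanh_half.
  have := expR_gt0 s; have := expR_gt0 t => E0 F0.
  by field; rewrite !gt_eqF//; lra.
- move=> U /nbhs_nsq[e e0 eU].
  apply: (@filterS _ (+oo : set_system R) _ _ _ _ (tanh_half_near1 e0)) => t t1.
  apply: eU.
  have -> : tanh_half t *: xi - xi = (tanh_half t - 1) *: xi by rewrite scalerBl scale1r.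
  by rewrite !dotE xi1 mulr1 -expr2 -sqrrN opprB.
Qed.

(** Equality in the triangle inequality for [0], [rho s], [rho t] makes these
points aligned; letting [t] go to infinity puts [rho s] on the segment from [0]
to [xi]. *)
Lemma geodesic_ray_unique rho xi s : geodesic_ray rho 0 xi -> 0 <= s ->
  rho s = tanh_half s *: xi.
Proof.
move=> [rho0 rhoD rhod rholim] s0.
have nrho t : 0 <= t -> nsq (rho t) = tanh_half t ^+ 2.
  move=> t0; have /hdist_expR := rhod t 0 t0 (lexx 0).
  rewrite subr0 normr_ge0 ger0_norm// => /(_ (rhoD _ t0) (rhoD _ (lexx 0)) isT).
  have := Disc_subr_gt0 (rhoD _ t0); have := expR_gt0 t.
  rewrite rho0 /sinh2 /tanh_half dot0l !subr0 mulr1 => E0 n0 e.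
  have {}e : 4 * nsq (rho t) * expR t = (expR t - 1) ^+ 2 * (1 - nsq (rho t)).
    by rewrite -e; field; rewrite gt_eqF.
  have E1 : (expR t + 1) ^+ 2 != 0 by rewrite expf_neq0// gt_eqF//; lra.
  by apply: (mulfI E1); rewrite expr_div_n mulrCA divff// mulr1; lra.
have drho t : s <= t -> dot (rho s) (rho t) = tanh_half s * tanh_half t.
  move=> st; have t0 : 0 <= t by exact: le_trans st.
  have /hdist_expR := rhod s t s0 t0.
  rewrite ler0_norm ?subr_le0// opprB subr_ge0.
  move=> /(_ (rhoD _ s0) (rhoD _ t0) st).
  have nst := sinh2_nsq (rhoD _ s0) (rhoD _ t0).
  have := nrho s s0; have := nrho t t0 => nt ns.
  move: nst; rewrite !dotE (dotC (rho t)) nt ns.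
  move: (sinh2 _ _) (dot _ _) => S b nst.
  have {nst} -> : b = (tanh_half s ^+ 2 + tanh_half t ^+ 2 -
      S * ((1 - tanh_half s ^+ 2) * (1 - tanh_half t ^+ 2))) / 2 by lra.
  rewrite !tanh_half_depth expRB /tanh_half.
  have := expR_gt0 s; have := expR_gt0 t; move: (expR s) (expR t) => E F F0 E0 e.
  have -> : S = (F - E) ^+ 2 / (4 * E * F).
    have -> : S = 4 * S * (F / E) * E / (4 * F) by field; rewrite !gt_eqF.
    by rewrite e; field; rewrite !gt_eqF.
  by field; rewrite !gt_eqF//; lra.
have /andP[h0 h1] := tanh_half_itv s0.
apply: nsq_small_eq => e e0.
have e4 : 0 < e / 4 by lra.
have [t [[t1 t2] t3]] : exists t, ((1 - tanh_half t) ^+ 2 < e / 4 /\ s <= t) /\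
    nsq (rho t - xi) < e / 4.
  apply: (@filter_ex _ (+oo : set_system R)).
  apply: filterI; first apply: filterI.
  - exact: tanh_half_near1.
  - by apply: nbhs_pinfty_ge; rewrite num_real.
  - apply: (rholim [set y | nsq (y - xi) < e / 4]).
    by apply/nbhs_nsq; exists (e / 4).
apply: le_lt_trans (nsqB_le _ (tanh_half s *: rho t) _) _.
have -> : nsq (rho s - tanh_half s *: rho t) = tanh_half s ^+ 2 * (1 - tanh_half t) ^+ 2.
  by rewrite !dotE (dotC (rho t)) !drho// !nrho//; [ring|exact: le_trans t2].
have -> : nsq (tanh_half s *: rho t - tanh_half s *: xi) =
  tanh_half s ^+ 2 * nsq (rho t - xi) by rewrite -scalerBr dotZl dotZr; ring.
have s1 : tanh_half s ^+ 2 <= 1 by rewrite exprn_ile1// ltW.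
have := ler_wpM2r (nsq_ge0 (rho t - xi)) s1.
have := ler_wpM2r (sqr_ge0 (1 - tanh_half t)) s1.
by rewrite !mul1r; lra.
Qed.

Lemma ray_segment xi : Sphere xi ->
  ray xi = [set r *: xi | r in [set r | 0 <= r < 1]].
Proof.
move=> xi1; apply/seteqP; split => x.
  move=> [rho [t [rho_ray t0 ->]]]; exists (tanh_half t); first exact: tanh_half_itv.
  by rewrite (geodesic_ray_unique rho_ray).
move=> [r /= /andP[r0 r1] <-].
pose q := (1 + r) / (1 - r).
have q1 : 1 <= q by rewrite ler_pdivlMr; lra.
exists (fun t => tanh_half t *: xi), (ln q); split.
- exact: sphere_point_geodesic.
- exact: ln_ge0.
- rewrite /tanh_half lnK; last by rewrite posrE; lra.
  congr (_ *: _); rewrite /q; field; rewrite !gt_eqF//; lra.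
Qed.

End Hyperbolic.

(** * Finite maxima, minima and pigeonholes *)

Section Finite.
Set Implicit Arguments. Unset Strict Implicit.
Context {R : realType}.

Lemma finite_ubound (T : finType) (F : T -> R) :
  exists2 M, 0 <= M & forall t, F t <= M.
Proof.
exists (\big[Order.max/0]_t F t); first exact: bigmax_ge_id.
by move=> t; exact: le_bigmax.
Qed.

Lemma finite_pos_lbound (T : finType) (F : T -> R) : (forall t, 0 < F t) ->
  exists2 e, 0 < e & forall t, e <= F t.
Proof.
move=> F0; exists (\big[Order.min/1]_t F t); first exact: lt_bigmin.
by move=> t; exact: bigmin_le.
Qed.

Lemma finite_set_ubound (T : Type) (A : set T) (F : T -> R) : finite_set A ->
  exists2 M, 0 <= M & forall t, A t -> F t <= M.
Proof.
move=> /(finite_image F)/finite_seqP[s sE].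
exists (\big[Order.max/0]_(x <- s) x); first exact: bigmax_ge_id.
move=> t At; apply: le_bigmax_seq => //.
by have : (F @` A) (F t) by [exists t]; rewrite sE.
Qed.

(** Otherwise every [t] fails at some scale, and the smallest of these finitely many
scales has no [t]. *)
Lemma small_scale_pigeonhole (T : finType) (Q : T -> R -> Prop) :
  (forall t e e', Q t e -> e <= e' -> Q t e') ->
  (forall e, 0 < e -> exists t, Q t e) -> exists t, forall e, 0 < e -> Q t e.
Proof.
move=> Qmono Qex; apply: contrapT => no.
have bad t : exists e, 0 < e /\ ~ Q t e.
  apply: contrapT => h; apply: no; exists t => e e0.
  by apply: contrapT => nQ; apply: h; exists e.
have [F FP] := choice bad.
have [e e0 eF] := finite_pos_lbound (fun t => (FP t).1).
have [t Qt] := Qex e e0.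
by apply: (FP t).2; exact: Qmono (eF t).
Qed.

End Finite.

(** * Words in a Schottky group *)

Section Words.
Set Implicit Arguments. Unset Strict Implicit.
Context {R : realType} {m d : nat}.
Local Notation V := 'rV[R]_m.+1.
Local Notation letter := ('I_d * bool)%type.
Context (ctr : letter -> V) (rad : letter -> R) (g : 'I_d -> V -> V).
Context (hG : schottky_type ctr rad g).
Implicit Types (x y z : V) (f : V -> V) (v u w : letter) (s : seq letter).

Local Notation G := (schottky_group g).
Local Notation D := (D_ ctr rad).

Definition eval_word s : V -> V := foldr (fun v f => vertex g v \o f) id s.

Definition reduced s : bool := sorted (fun v w => w != letter_inv v) s.

Definition inv_word s : seq letter := rev (map letter_inv s).

Lemma letter_invK : involutive (@letter_inv d).
Proof. by move=> [n b]; rewrite /letter_inv /= negbK. Qed.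

Lemma inv_mapK f : bijective f -> cancel f (inv_map f) /\ cancel (inv_map f) f.
Proof.
move=> [h fK hK]; split => x.
  by apply: pinvKV; rewrite ?inE// => y z _ _; exact: can_inj fK _ _.
by apply: pinvK; rewrite inE; exists (h x).
Qed.

Lemma generator_moebius n : moebius (g n).
Proof.
by have [Cf _ _ [gam [_ _ _]]] := hG.2 n; exact: translation_moebius.
Qed.

Lemma vertexK v : cancel (vertex g v) (vertex g (letter_inv v)).
Proof.
case: v => n b; have [gb _ _] := generator_moebius n.
by have [gK gK'] := inv_mapK gb; case: b => x; rewrite /vertex /= ?gK ?gK'.
Qed.

Lemma vertexVK v : cancel (vertex g (letter_inv v)) (vertex g v).
Proof. by move=> x; rewrite -{1}(letter_invK v) vertexK. Qed.

Lemma vertex_moebius v : moebius (vertex g v).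
Proof.
have gM := generator_moebius v.1; have [gb _ _] := gM.
have [gK gK'] := inv_mapK gb; rewrite /vertex; case: ifP => // _.
exact: moebius_inverse gK gK'.
Qed.

Lemma eval_word_moebius s : moebius (eval_word s).
Proof.
elim: s => [|v s IH] /=; first exact: moebius_id.
by apply: moebius_comp => //; exact: vertex_moebius.
Qed.

Lemma eval_word_cat s t : eval_word (s ++ t) = eval_word s \o eval_word t.
Proof. by elim: s => [|v s IH] //=; rewrite IH. Qed.

Lemma eval_inv_word s : cancel (eval_word s) (eval_word (inv_word s)).
Proof.
elim: s => [|v s IH] x //=.
by rewrite /inv_word /= rev_cons -cats1 eval_word_cat /= vertexK IH.
Qed.

Lemma inv_wordK : involutive inv_word.
Proof.
move=> s; rewrite /inv_word map_rev revK -map_comp.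
by rewrite -[RHS]map_id; apply: eq_map => v /=; rewrite letter_invK.
Qed.

Lemma inv_map_eval_word s : inv_map (eval_word s) = eval_word (inv_word s).
Proof.
have [sb _ _] := eval_word_moebius s; have [sK _] := inv_mapK sb.
apply/funext => x; rewrite -[in LHS](inv_wordK s).
by rewrite -{1}(eval_inv_word (inv_word s) x) inv_wordK sK.
Qed.

(** Free reduction: a cancelling letter is dropped as the word is built up from its
end. *)
Lemma eval_word_reduced s : exists2 t, reduced t & eval_word s = eval_word t.
Proof.
elim: s => [|v s [t tred st]]; first by exists [::].
case: t tred st => [|w t] tred st; first by exists [:: v]; rewrite //= st.
have [wv|wv] := eqVneq w (letter_inv v).
  exists t; first by move: tred; rewrite /reduced /=; exact: path_sorted.
  by rewrite /= st; apply/funext => x /=; rewrite wv vertexVK.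
by exists [:: v, w & t]; [rewrite /reduced /= wv|rewrite /= st].
Qed.

Lemma schottky_group_subgroup : subgroup G.
Proof.
split=> [H [[? _ _] _]|f h fG hG' H HP|f fG H HP] //.
- by have [[_ HM _] _] := HP; apply: HM; [exact: fG|exact: hG'].
- by have [[_ _ HV] _] := HP; apply: HV; exact: fG.
Qed.

Lemma schottky_groupP f : G f <-> exists2 s, reduced s & f = eval_word s.
Proof.
have [G1 GM GV] := schottky_group_subgroup.
have Gg n : G (g n) by move=> H [_]; apply; exists n.
split=> [Gf|[s _ ->]]; last first.
  elim: s => [//|v s IH]; apply: GM => //; rewrite /vertex.
  by case: ifP => _; [exact: Gg|apply: GV; exact: Gg].
suff [s ->] : exists s, f = eval_word s.
  by have [t tred ->] := eval_word_reduced s; exists t.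
apply: (Gf [set f | exists s, f = eval_word s]); split.
  split => [|_ _ [s ->] [t ->]|_ [s ->]]; first by exists [::].
    by exists (s ++ t); rewrite eval_word_cat.
  by exists (inv_word s); rewrite inv_map_eval_word.
by move=> _ [n _ <-]; exists [:: (n, true)].
Qed.

Lemma schottky_group_moebius f : G f -> moebius f.
Proof. by move=> /schottky_groupP[s _ ->]; exact: eval_word_moebius. Qed.

Lemma schottky_group_inv f : G f ->
  [/\ G (inv_map f), cancel f (inv_map f) & cancel (inv_map f) f].
Proof.
move=> fG; have [fb _ _] := schottky_group_moebius fG.
have [fK fK'] := inv_mapK fb; split => //.
by have [_ _] := schottky_group_subgroup; apply.
Qed.

(** A ball of centre [a] and radius [r] orthogonal to the unit sphere has
[|a|^2 = 1 + r^2]. *)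
Lemma origin_notin_ball v : rad v < enorm (ctr v).
Proof.
have [[rad0 _ /(_ v)[[x [xa x1]] orth] _] _] := hG.
have r0 := rad0 v; have xax := orth x xa x1.
have /SphereE xx := x1; move: xa; rewrite /esphere /= => /(congr1 (fun t => t ^+ 2)).
rewrite enorm_sqr; rewrite !dotE xx in xax *; rewrite (dotC x) => e.
rewrite -(ltr_pXn2r (_ : 0 < 2)%N) ?nnegrE ?enorm_ge0 ?(ltW r0)// enorm_sqr.
by lra.
Qed.

Lemma ball_gap : exists2 e, 0 < e &
  (forall v w x y, v != w -> D v x -> D w y -> e <= nsq (x - y)) /\
  (forall v x, D v x -> e <= nsq x).
Proof.
have [[rad0 disj _ _] _] := hG.
have pairs (p : letter * letter) : exists e, 0 < e /\
    forall x y, p.1 != p.2 -> D p.1 x -> D p.2 y -> e <= nsq (x - y).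
  have [p12|p12] := eqVneq p.1 p.2; first by exists 1; split.
  have [e e0 he] := disjoint_ecballs (rad0 p.1) (rad0 p.2) (disj _ _ p12).
  by exists e; split => // x y _; exact: he.
have [F FP] := choice pairs.
have [e1 e1_gt0 e1F] := finite_pos_lbound (fun p => (FP p).1).
have c0 v : 0 < (enorm (ctr v) - rad v) ^+ 2.
  by rewrite exprn_gt0// subr_gt0 origin_notin_ball.
have [e2 e2_gt0 e2F] := finite_pos_lbound c0.
exists (Order.min e1 e2); first by rewrite lt_min e1_gt0.
split => [v w x y vw Dx Dy|v x Dx].
  rewrite ge_min; apply/orP; left; apply: le_trans (e1F (v, w)) _.
  exact: (FP (v, w)).2.
rewrite ge_min; apply/orP; right; apply: le_trans (e2F v) _.
have := origin_notin_ball v; have := enormD (ctr v - x) x; rewrite subrK.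
rewrite enormBC; move: Dx; rewrite /D_ /ecball /= => Dx h1 h2.
by rewrite -enorm_sqr ler_pXn2r ?nnegrE ?enorm_ge0//; lra.
Qed.

(** For an inverse generator this follows from the statement for the generator, by
contraposition. *)
Lemma vertex_pingpong v x : Disc x -> ~ D (letter_inv v) x -> D v (vertex g v x).
Proof.
case: v => n b xD nDx; have [_ _ gD _] := hG.2 n.
have img y : Disc y -> ~ D (n, false) y -> D (n, true) (g n y).
  move=> yD nDy; have : (Disc `&` eball (ctr (n, true)) (rad (n, true))) (g n y).
    by rewrite -gD; exists y.
  by move=> [_ /ltW].
case: b nDx => nDx; first exact: img.
apply: contrapT => nDy; apply: nDx; rewrite /letter_inv /=.
have vM := vertex_moebius (n, false).
rewrite -(vertexVK (n, true) x); apply: img => //.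
exact/(moebius_Disc _ vM).
Qed.

(** Ping-pong started at the origin, which lies outside all the balls. *)
Lemma eval_word_first v s : reduced (v :: s) -> D v (eval_word (v :: s) 0).
Proof.
have [e e0 [gap gap0]] := ball_gap.
elim: s v => [|w s IH] v /= vs.
  apply: vertex_pingpong; first exact: Disc0.
  by move=> /gap0; rewrite dot0l leNgt e0.
move: vs; rewrite /reduced /= => /andP[wv ws]; apply: vertex_pingpong.
  exact/(moebius_Disc _ (eval_word_moebius (w :: s)))/Disc0.
by move=> /(gap _ _ _ _ wv (IH w ws)); rewrite subrr dot0l leNgt e0.
Qed.

(** Discreteness: for [f <> h] in the group, [f^-1 h] is a non-empty reduced word,
so it moves the origin into one of the balls.  Hence the orbit of the origin is
separated in hyperbolic distance, and only finitely many of its points lie in a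
compact part of the ball. *)
Lemma shallow_elements_finite r : 0 < r ->
  finite_set [set f | G f /\ r <= 1 - nsq (f 0)].
Proof.
move=> r0; have [e e0 [_ gap0]] := ball_gap.
have GD f : G f -> Disc (f 0).
  by move=> /schottky_group_moebius fM; apply/(moebius_Disc _ fM)/Disc0.
apply: (@separated_finite _ _ _ _ (fun f => f 0) (e * (r * r))).
- by rewrite !mulr_gt0.
- by move=> f [/GD/DiscE/ltW].
move=> f h [fG fr] [hG' hr] fh.
have [fVG fK fVK] := schottky_group_inv fG.
have [_ GM _] := schottky_group_subgroup.
have /schottky_groupP[[|v s] sred sE] := GM _ _ fVG hG'.
  by case: fh; apply/funext => x; rewrite -[RHS]fVK -[inv_map f _]/((_ \o h) x) sE.
have hE : h 0 = f (eval_word (v :: s) 0) by rewrite -sE /= fVK.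
have yD : Disc (eval_word (v :: s) 0) by exact/(moebius_Disc _ (eval_word_moebius _))/Disc0.
rewrite sinh2_nsq; [|exact: GD|exact: GD].
rewrite {1}hE sinh2_moebius; [|exact: schottky_group_moebius|exact: Disc0|by []].
have y0 := gap0 _ _ (eval_word_first sred).
apply: ler_pM => //; [exact: ltW|by rewrite mulr_ge0// ltW| |by apply: ler_pM => //; exact: ltW].
apply: (le_trans y0); have := Disc_subr_gt0 yD; have := nsq_ge0 (eval_word (v :: s) 0).
rewrite /sinh2 sub0r nsqN dot0l subr0 mul1r => a b.
by rewrite ler_pdivlMr//; rewrite ler_piMr//; lra.
Qed.

Lemma near_elements_finite K : 0 <= K ->
  finite_set [set f | G f /\ sinh2 0 (f 0) <= K].
Proof.
move=> K0; have r0 : 0 < (4 * (1 + K))^-1 by rewrite invr_gt0; lra.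
apply: sub_finite_set (shallow_elements_finite r0) => f [fG fK]; split => //.
have fD : Disc (f 0).
  by apply/(moebius_Disc _ (schottky_group_moebius fG))/Disc0.
have := depth_le Disc0 fD; rewrite dot0l subr0 => h.
have d0 := Disc_subr_gt0 fD.
rewrite -[leLHS]mulr1 mulrC ler_pdivrMr; last by lra.
rewrite mulrC; apply: (le_trans h); rewrite ler_pM2r//; lra.
Qed.

End Words.

(** * The coding map *)

Section Coding.
Set Implicit Arguments. Unset Strict Implicit.
Context {R : realType} {m d : nat}.
Local Notation V := 'rV[R]_m.+1.
Local Notation letter := ('I_d * bool)%type.
Context (ctr : letter -> V) (rad : letter -> R) (g : 'I_d -> V -> V).
Context (hG : schottky_type ctr rad g).
Implicit Types (x y z xi : V) (f : V -> V) (v u w : letter) (n : nat).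
Implicit Types (om : nat -> letter * letter) (e r t : R).

Local Notation G := (schottky_group g).
Local Notation D := (D_ ctr rad).
Local Notation X := (X_ ctr rad).
Local Notation vertex := (vertex g).
Local Notation word := (word g).

(** One inclusion of [coded_by]; the other one is a consequence, as cylinders
shrink. *)
Definition in_cylinders om x : Prop :=
  forall n, (comp_prefix (phi g \o om) n.+1 @` X (om n).2) x.

Definition om_letters om i n : seq letter := [seq (om j).1 | j <- iota i n].

Lemma om_letters_rcons om n :
  om_letters om 0 n.+1 = rcons (om_letters om 0 n) (om n).1.
Proof. by rewrite /om_letters -[n.+1]addn1 iotaD map_cat cats1. Qed.

Lemma word_eval om n : word om n = eval_word g (om_letters om 0 n).
Proof.
rewrite /Defs.word; elim: n => [//|n IH].
by rewrite om_letters_rcons -cats1 eval_word_cat -IH.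
Qed.

Lemma word_cat om i n :
  word om (i + n) = word om i \o eval_word g (om_letters om i n).
Proof. by rewrite !word_eval -eval_word_cat /om_letters iotaD map_cat. Qed.

Lemma om_letters_reduced om i n : Sigma om -> reduced (om_letters om i n).
Proof.
move=> [om_edge om_next]; rewrite /reduced /om_letters.
have nxt j : (om j.+1).1 != letter_inv (om j).1.
  apply/eqP => e; apply: (om_edge j); rewrite /edge om_next e.
  by rewrite letter_invK.
case: n => [//|n] /=; elim: n i => [//|n IH] i /=.
by rewrite nxt IH.
Qed.

Lemma word_group om n : G (word om n).
Proof.
rewrite word_eval; apply/(schottky_groupP hG).
by have [t tr ->] := eval_word_reduced hG (om_letters om 0 n); exists t.
Qed.

Lemma word_moebius om n : moebius (word om n).
Proof. by rewrite word_eval; exact: eval_word_moebius hG _. Qed.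

Lemma word_Disc om n x : Disc x -> Disc (word om n x).
Proof. by move=> xD; apply/(moebius_Disc _ (word_moebius om n)). Qed.

Lemma word_inj om : Sigma om -> injective (word om).
Proof.
move=> omS; suff lt_neq i n : (i < n)%N -> word om i <> word om n.
  by move=> i n E; case: (ltngtP i n) => // /lt_neq; [|move/nesym]; rewrite E.
move=> lt_in E; have [e e0 [_ gap0]] := ball_gap hG.
have [[h hK _] _ _] := word_moebius om i.
move: E; rewrite -(subnKC (ltnW lt_in)) word_cat => /(congr1 (fun f => h (f 0))).
rewrite /= !hK; have := om_letters_reduced i (n - i) omS.
rewrite -subn_gt0 in lt_in; case: (n - i)%N lt_in => [//|k] _.
by move=> /(eval_word_first hG)/gap0 + E; rewrite -E dot0l leNgt e0.
Qed.

Lemma shallow_words_finite om r : Sigma om -> 0 < r ->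
  finite_set [set n | r <= 1 - nsq (word om n 0)].
Proof.
move=> omS r0.
have := @finite_preimage _ _ [set f | G f /\ r <= 1 - nsq (f 0)] (word om).
move=> /(_ (fun i j _ _ => @word_inj om omS i j)).
move=> /(_ (shallow_elements_finite hG r0)); apply: sub_finite_set => n /= rn.
by split => //; exact: word_group.
Qed.

Lemma deep_word om r : Sigma om -> 0 < r -> exists n, 1 - nsq (word om n 0) < r.
Proof.
move=> omS r0; apply: contrapT => no; apply: infinite_nat.
apply: sub_finite_set (shallow_words_finite omS r0) => n _ /=.
by rewrite leNgt; apply/negP => lt; apply: no; exists n.
Qed.

Lemma in_cylinders_cDisc om x : in_cylinders om x -> cDisc x.
Proof.
move=> /(_ 0%N)[y [yD _] <-] /=.
by have [_ vD _] := vertex_moebius hG (om 0).1; apply/vD.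
Qed.

(** The pole of [v_1 ... v_n] lies in the ball of [v_n^-1], hence away from the
points that this word maps into the cylinder of the coded point. *)
Lemma cylinder_shadow : exists2 C, 0 < C & forall om x, Sigma om ->
  in_cylinders om x ->
  forall n, nsq (word om n 0 - x) <= C * (1 - nsq (word om n 0)) ^+ 2.
Proof.
have [e e0 [gap _]] := ball_gap hG.
have C0 : 0 < e^-1 by rewrite invr_gt0.
exists (1 + e^-1); first by lra.
move=> om x omS omx [|n].
  rewrite /= dot0l subr0 expr1n mulr1 sub0r nsqN.
  by have /cDiscE := in_cylinders_cDisc omx; lra.
have [y [yD yX] <-] := omx n.
rewrite -/(word om n.+1).
set w := word om n.+1; have wM : moebius w by exact: word_moebius.
set s := om_letters om 0 n.
pose p := eval_word g (inv_word (rcons s (om n).1)) 0.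
have wE : w = eval_word g (rcons s (om n).1).
  by rewrite /w word_eval om_letters_rcons.
have wp : w p = 0.
  by rewrite wE /p -{1}(inv_wordK (rcons s (om n).1)) (eval_inv_word hG).
have pD : Disc p by apply/(moebius_Disc _ wM); rewrite wp; exact: Disc0.
have pX : D (letter_inv (om n).1) p.
  rewrite /p /inv_word map_rcons rev_rcons; apply: (eval_word_first hG).
  rewrite -rev_rcons -map_rcons -/(inv_word _).
  (* the inverse of a reduced word is reduced *)
  have : reduced (rcons s (om n).1).
    by rewrite -om_letters_rcons; exact: om_letters_reduced.
  rewrite /reduced /inv_word rev_sorted sorted_map; apply: sub_sorted => u v /=.
  by rewrite letter_invK => /eqP vu; apply/eqP => uv; apply: vu; rewrite uv.
have ep : e <= nsq (y - p).
  rewrite nsqBC; apply: gap pX yX; apply/eqP => E; apply: (omS.1 n).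
  by rewrite /edge -E letter_invK.
have := moebius_shadow wM yD pD wp; set A := nsq (w 0 - w y) => h.
have A0 : 0 <= A by exact: nsq_ge0.
have : A * e <= (1 - nsq (w 0)) ^+ 2 by apply: le_trans h; rewrite ler_wpM2l.
rewrite -ler_pdivlMr// mulrC => le1; apply: (le_trans le1).
by rewrite ler_wpM2r ?sqr_ge0//; lra.
Qed.

(** The points [v_1 ... v_n 0] converge to [x] and tend to the sphere. *)
Lemma in_cylinders_Sphere om x : Sigma om -> in_cylinders om x -> Sphere x.
Proof.
move=> omS omx; have [C C0 shadow] := cylinder_shadow.
have xD := in_cylinders_cDisc omx; apply/SphereE/eqP; rewrite eq_le.
have /cDiscE x1 := xD; rewrite x1 /= leNgt; apply/negP => xlt.
set a := (1 - nsq x) ^+ 2; have a0 : 0 < a by rewrite exprn_gt0// subr_gt0.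
(* at depth below [r <= 1], [bracket_ge] gives [a < 4 (C + 1) r] *)
pose r := Order.min 1 (a / (4 * (C + 1))).
have r0 : 0 < r by rewrite lt_min ltr01 divr_gt0//; lra.
have [n nr] := deep_word omS r0.
have wD := word_Disc om n Disc0; have /DiscE/ltW w1 := wD.
have h := shadow om x omS omx n; have d0 := Disc_subr_gt0 wD.
have := bracket_ge w1 x1; rewrite -/a; move: h nr d0.
move: (nsq (_ - x)) (1 - nsq (word _ _ _)) => N q h; rewrite lt_min => /andP[q1 qa] q0.
rewrite ltr_pdivlMr in qa; last by lra.
have : q ^+ 2 <= q by rewrite expr2 ler_piMr// ltW.
have : q * (1 - nsq x) <= q.
  by rewrite ler_piMr ?(ltW q0)//; have := nsq_ge0 x; lra.
nra.
Qed.

Lemma in_cylinders_coded om x : Sigma om -> in_cylinders om x ->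
  coded_by ctr rad g om x.
Proof.
move=> omS omx; have [C C0 shadow] := cylinder_shadow.
apply/seteqP; split => [y omy|_ -> n _]; last exact: omx.
have {}omy : in_cylinders om y by move=> n; exact: omy.
apply: nsq_small_eq => e e0.
have r0 : 0 < Order.min 1 (e / (4 * C)) by rewrite lt_min ltr01 divr_gt0//; lra.
have [n] := deep_word omS r0; rewrite lt_min => /andP[q1 qe].
have q0 := Disc_subr_gt0 (word_Disc om n Disc0).
apply: le_lt_trans (nsqB_le _ (word om n 0) _) _.
rewrite (nsqBC y); have := shadow om y omS omy n; have := shadow om x omS omx n.
rewrite ltr_pdivlMr in qe; last by lra.
move: (1 - nsq _) q1 qe q0 => q q1 qe q0.
have : C * q ^+ 2 <= C * q by rewrite ler_pM2l// expr2 ler_piMr// ltW.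
lra.
Qed.

Lemma coded_in_cylinders om x : coded_by ctr rad g om x -> in_cylinders om x.
Proof. by move=> omx n; have : [set x] x by []; rewrite -omx; apply. Qed.

(** If [q] and the point [t *: xi] of the ray have comparable depths, then both are
at Euclidean distance from [xi] at most of the order of this depth, which bounds
their hyperbolic distance. *)
Lemma sinh2_shadow q xi t C K : Disc q -> Sphere xi -> 0 <= t < 1 -> 0 < C ->
  nsq (q - xi) <= C * (1 - nsq q) ^+ 2 ->
  1 - t ^+ 2 <= 1 - nsq q <= K * (1 - t ^+ 2) ->
  sinh2 q (t *: xi) <= 2 * C * K + 2.
Proof.
move=> /Disc_subr_gt0 q0 /SphereE xi1 /andP[t0 t1] C0 qxi /andP[dl dK].
have txi : nsq (t *: xi) = t ^+ 2 by rewrite !dotE xi1 mulr1.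
have d0 : 0 < 1 - t ^+ 2 by rewrite subr_gt0 expr_lt1.
rewrite /sinh2 txi ler_pdivrMr ?mulr_gt0//.
apply: le_trans (nsqB_le _ xi _) _.
have -> : nsq (xi - t *: xi) = (1 - t) ^+ 2.
  by rewrite -{1 3}(scale1r xi) -scalerBl !dotE xi1 mulr1.
have h1 : (1 - t) ^+ 2 <= (1 - t ^+ 2) * (1 - nsq q).
  apply: (@le_trans _ _ ((1 - t ^+ 2) ^+ 2)).
    have t2 : t ^+ 2 <= t by rewrite expr2 ler_piMr// ltW.
    by rewrite ler_pXn2r ?nnegrE//; lra.
  by rewrite expr2 ler_pM2l.
have h2 : C * (1 - nsq q) ^+ 2 <= C * ((1 - nsq q) * (K * (1 - t ^+ 2))).
  by rewrite ler_pM2l// expr2 ler_pM2l.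
move: (nsq (q - xi)) (1 - nsq q) (1 - t ^+ 2) h1 h2 qxi => A B E h1 h2 h3.
lra.
Qed.

(** The point of the ray with the same Euclidean norm as [v_1 ... v_n 0] is close
to it. *)
Lemma words_near_ray : exists2 K, 0 <= K & forall om x, Sigma om ->
  in_cylinders om x -> forall n, exists y,
    [/\ ray x y, Disc y & sinh2 (word om n 0) y <= K].
Proof.
have [C C0 shadow] := cylinder_shadow.
exists (2 * C * 1 + 2); first by lra.
move=> om x omS omx n; have xS := in_cylinders_Sphere omS omx.
set q := word om n 0; have qD : Disc q by exact: word_Disc Disc0.
have tE : enorm q ^+ 2 = nsq q by exact: enorm_sqr.
have t1 : 0 <= enorm q < 1 by rewrite enorm_ge0; exact: qD.
exists (enorm q *: x); split.
- by rewrite ray_segment//; exists (enorm q).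
- by apply/DiscE; move/SphereE: xS => xS; rewrite !dotE xS mulr1 -expr2 tE; apply/DiscE.
- apply: sinh2_shadow => //; first exact: shadow.
  by rewrite tE mul1r lexx.
Qed.

(** Two consecutive points [v_1 ... v_n 0] are at bounded distance, so that their
depths, which start at [1] and tend to [0], skip no scale. *)
Lemma ray_near_words : exists2 K, 0 <= K & forall om x, Sigma om ->
  in_cylinders om x -> forall y, ray x y ->
    Disc y /\ exists n, sinh2 (word om n 0) y <= K.
Proof.
have [C C0 shadow] := cylinder_shadow.
have [M M0 step] := finite_ubound (fun v => sinh2 0 (vertex v 0)).
exists (2 * C * (4 * (1 + M)) + 2).
  have : 0 <= C * (4 * (1 + M)) by apply: mulr_ge0; lra.
  lra.
move=> om x omS omx y; have xS := in_cylinders_Sphere omS omx.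
rewrite ray_segment// => -[t /= t01 <-]; have /andP[t0 t1] := t01.
have d0 : 0 < 1 - t ^+ 2 by rewrite subr_gt0 expr_lt1.
split.
  by apply/DiscE; move/SphereE: xS => xS; rewrite !dotE xS mulr1 -expr2 -subr_gt0.
(* the last prefix of the coding that is not closer to the sphere than the point *)
have [n nlt nmin] := ex_minnP (deep_word omS d0).
case: n nlt nmin => [|n] nlt nmin.
  by move: nlt; rewrite /= dot0l; have := sqr_ge0 t; lra.
exists n; have wD := word_Disc om n Disc0.
apply: sinh2_shadow => //; first exact: shadow.
apply/andP; split.
  by rewrite leNgt; apply/negP => /nmin; rewrite ltnn.
apply: le_trans (depth_le wD (word_Disc om n.+1 Disc0)) _.
have S0 := sinh2_ge0 wD (word_Disc om n.+1 Disc0).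
have SM : sinh2 (word om n 0) (word om n.+1 0) <= M.
  rewrite -[word om n.+1 0]/(word om n (vertex (om n).1 0)).
  rewrite sinh2_moebius//; [exact: word_moebius|exact: Disc0|].
  exact/(moebius_Disc _ (vertex_moebius hG _))/Disc0.
apply: ler_pM; [lra|exact: ltW (Disc_subr_gt0 (word_Disc om n.+1 Disc0))| |exact: ltW].
by lra.
Qed.

(** * Limit points are coded *)

Definition orbit_limit x : Prop := Sphere x /\
  forall e, 0 < e -> exists2 f, G f & nsq (f 0 - x) < e.

(** Infinitely many of the approximating words share their first two letters
[v], [u]. This places [x] in the ball of [v], and [v^-1 x] in the ball of [u]. *)
Lemma orbit_limit_step x : orbit_limit x -> exists v u,
  [/\ u != letter_inv v, D v x, D u (vertex (letter_inv v) x)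
    & orbit_limit (vertex (letter_inv v) x)].
Proof.
move=> [xS xlim].
pose Q (p : option letter * option letter) e := exists s,
  [/\ reduced s, (ohead s, ohead (behead s)) = p & nsq (eval_word g s 0 - x) < e].
have [||[[v|] u] Qp] := @small_scale_pigeonhole R _ Q.
- move=> p e e' [s [sr sp se]] ee'; exists s; split => //; exact: lt_le_trans ee'.
- move=> e e0; have [f /(schottky_groupP hG)[s sr ->] fe] := xlim e e0.
  by exists (ohead s, ohead (behead s)), s.
- have xnD f : moebius f -> f 0 <> x.
    move=> fM fx; have : Disc (f 0) by apply/(moebius_Disc _ fM)/Disc0.
    by rewrite fx => /DiscE; move/SphereE: xS => ->; rewrite ltxx.
  case: u Qp => [u|] Qp; last first.
    exfalso; apply: (xnD _ (vertex_moebius hG v)); apply: nsq_small_eq => e e0.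
    by have [[|v' [|u' s]] [_ // + se]] := Qp e e0; case=> vv; rewrite -vv.
  have Qvu e : 0 < e -> exists s, [/\ reduced [:: v, u & s]
      & nsq (eval_word g [:: v, u & s] 0 - x) < e].
    move=> e0; have [[|v' [|u' s]] [sr // + se]] := Qp e e0.
    by case=> vv uu; exists s; rewrite -vv -uu.
  have hM := vertex_moebius hG (letter_inv v).
  have [L L0 lip] := moebius_lipschitz hM.
  have near e : 0 < e -> exists s, reduced (u :: s) /\
      nsq (eval_word g (u :: s) 0 - vertex (letter_inv v) x) < e.
    move=> e0; have eL : 0 < e / L by rewrite divr_gt0.
    have [s [sr se]] := Qvu _ eL; exists s; split.
      by move: sr; rewrite /reduced; exact: path_sorted.
    rewrite -[eval_word g (u :: s) 0](vertexK hG v).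
    apply: le_lt_trans (lip _ _ _ _) _.
    + by left; exact/(moebius_Disc _ (eval_word_moebius hG [:: v, u & s]))/Disc0.
    + by right.
    + by rewrite mulrC -ltr_pdivlMr.
  exists v, u; split.
  + by have [s [/andP[]]] := Qvu 1 ltr01.
  + apply: ecball_closed => e /Qvu[s [sr se]].
    exists (eval_word g [:: v, u & s] 0); first exact: (eval_word_first hG sr).
    by rewrite nsqBC.
  + apply: ecball_closed => e /near[s [sr se]].
    exists (eval_word g (u :: s) 0); first exact: (eval_word_first hG sr).
    by rewrite nsqBC.
  + split.
      have [_ hD _] := hM; have [|//] : cDisc (vertex (letter_inv v) x).
        by apply/hD; right.
      move=> /(moebius_Disc _ hM)/DiscE; move/SphereE: xS => ->; by rewrite ltxx.
    move=> e /near[s [sr se]]; exists (eval_word g (u :: s)) => //.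
    by apply/(schottky_groupP hG); exists (u :: s).
- exfalso; have : (0 : V) <> x.
    by move=> x0; move/SphereE: xS; rewrite -x0 dot0l => /eqP; rewrite eq_sym oner_eq0.
  apply; apply: nsq_small_eq => e e0.
  by have [[|v' s] [_ // _ se]] := Qp e e0.
Qed.

(** Iterating the previous lemma produces the letters; the letter [u] found at one
step is the letter [v] of the next one since the balls are disjoint, so the
sequence is admissible. *)
Lemma orbit_limit_coded x : orbit_limit x ->
  exists2 om, Sigma om & in_cylinders om x.
Proof.
move=> xlim; pose T := {y : V | orbit_limit y}.
have [[_ disj _ _] _] := hG.
have next (z : T) : exists p : letter * T, [/\ D p.1 (sval z),
    vertex p.1 (sval p.2) = sval z
  & exists2 u, u != letter_inv p.1 & D u (sval p.2)].
  have [v [u [uv vz uz lz]]] := orbit_limit_step (svalP z).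
  by exists (v, exist _ _ lz); split => //=; [exact: vertexVK hG _ _|exists u].
have [F FP] := choice next.
pose orb n : T := iter n (fun p => (F p).2) (exist _ x xlim).
pose a n := (F (orb n)).1.
have zx n : comp_prefix (fun i => vertex (a i)) n (sval (orb n)) = x.
  by elim: n => [//|n IH] /=; have [_ -> _] := FP (orb n).
exists (fun n => (a n, a n.+1)).
  split => // n; rewrite /edge /= => an.
  have [_ _ [u un uz]] := FP (orb n); have [az _ _] := FP (orb n.+1).
  have [ua|ua] := eqVneq u (a n.+1).
    by move: un; rewrite ua -/(a n) an letter_invK eqxx.
  suff : set0 (sval (orb n.+1)) by [].
  by rewrite -(disj _ _ ua); split.
move=> n; exists (sval (orb n.+1)); last exact: (zx n.+1).
split; last by have [] := FP (orb n.+1).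
by right; exact: (svalP (orb n.+1)).1.
Qed.

(** * Subgroups and the two notions of limit sets *)

Section Subgroup.
Context (N : set (V -> V)) (N1 : subgroup N) (NG : N `<=` G).

Lemma limit_set_coded x : limit_set N x ->
  exists2 om, Sigma om & in_cylinders om x.
Proof.
move=> [xS xlim]; apply: orbit_limit_coded; split => // e e0.
have [|y [_ [f fN <-] fe]] := xlim 0 Disc0 [set y | nsq (y - x) < e].
  by apply/nbhs_nsq; exists e.
by exists f => //; exact: NG.
Qed.

Lemma G_orbit f : G f -> Disc (f 0).
Proof.
by move=> /(schottky_group_moebius hG) fM; apply/(moebius_Disc _ fM)/Disc0.
Qed.

(** A word and an element of [N] that move the origin to nearby points differ by
an element of [G] of bounded displacement. *)
Lemma word_translate om n f K : N f -> sinh2 (f 0) (word om n 0) <= K ->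
  exists2 h, G h /\ sinh2 0 (h 0) <= K & f \o h = word om n.
Proof.
move=> /NG fG fK; have [fVG fVK fKV] := schottky_group_inv hG fG.
have [_ GM _] := schottky_group_subgroup g.
have hGG : G (inv_map f \o word om n) by exact: GM fVG (word_group om n).
exists (inv_map f \o word om n); last by apply/funext => y /=; rewrite fKV.
split => //; rewrite -(sinh2_moebius (schottky_group_moebius hG fG)) /=.
- by rewrite fKV.
- exact: Disc0.
- exact: (G_orbit hGG).
Qed.

(** If [v_1 ... v_n = f h], then [f z] is the image of [h^-1 z] under [v_1 ... v_n],
at a fixed hyperbolic distance from [v_1 ... v_n 0]; both converge to [x]. *)
Lemma radial_coded_limit om x h : Sigma om -> in_cylinders om x -> G h ->
  infinite_set [set n | (0 < n)%N /\ translates N [set h] (word om n)] ->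
  limit_set N x.
Proof.
move=> omS omx hGG inf; split; first exact: in_cylinders_Sphere omx.
have xS := in_cylinders_Sphere omS omx.
move=> z zD U /nbhs_nsq[e e0 eU].
have [C C0 shadow] := cylinder_shadow.
have [hVG hK hVK] := schottky_group_inv hG hGG.
set z' := inv_map h z.
have z'D : Disc z' by apply/(moebius_Disc _ (schottky_group_moebius hG hVG)).
have S0 := sinh2_ge0 z'D Disc0; set S := sinh2 z' 0 in S0.
have r0 : 0 < Order.min 1 (e / (2 * S + 2 * C)).
  by rewrite lt_min ltr01 divr_gt0//; lra.
have [n [[_ [f fN [_ -> fh]]] /negP]] :=
  infinite_setN0 (infinite_setD inf (shallow_words_finite omS r0)).
rewrite -ltNge lt_min => /andP[q1 qe].
have fz : f z = word om n z' by rewrite -fh /= hVK.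
have fzD : Disc (f z) by apply/(moebius_Disc _ (schottky_group_moebius hG (NG fN))).
exists (f z); split.
- apply/eqP => fzx; move/DiscE: fzD; rewrite fzx.
  by move/SphereE: xS => ->; rewrite ltxx.
- by exists f.
apply: eU; apply: le_lt_trans (nsqB_le _ (word om n 0) _) _.
have wD := word_Disc om n Disc0; have wz'D := word_Disc om n z'D.
have h1 := shadow om x omS omx n; have q0 := Disc_subr_gt0 wD.
rewrite fz (sinh2_nsq wz'D wD) (sinh2_moebius (word_moebius om n) z'D Disc0) -/S.
have z1 : 1 - nsq (word om n z') <= 1.
  by have := nsq_ge0 (word om n z'); lra.
rewrite ltr_pdivlMr in qe; last by lra.
have h2 : S * ((1 - nsq (word om n z')) * (1 - nsq (word om n 0))) <=
    S * (1 - nsq (word om n 0)).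
  by rewrite ler_wpM2l// ler_piMl// ltW.
have h3 : C * (1 - nsq (word om n 0)) ^+ 2 <= C * (1 - nsq (word om n 0)).
  by rewrite ler_pM2l// expr2 ler_piMr// ltW.
lra.
Qed.

(** Each of the infinitely many [f] in [N] is a prefix times the inverse of one of
finitely many [h], so that some [h] occurs with infinitely many prefixes. *)
Lemma radial_limit_set_sub : radial_limit_set N `<=` Lambda_r ctr rad g N.
Proof.
move=> x [xlim [c c0 inf]]; have [om omS omx] := limit_set_coded xlim.
have [K K0 near] := ray_near_words.
pose K' := triangle_bound (expR c) K.
have K'0 : 0 <= K' by exact: triangle_bound_ge0 (expR_ge0 c) K0.
exists om; split => //; first exact: in_cylinders_coded.
apply: contrapT => no; apply: inf.
pose Gam := [set h | G h /\ sinh2 0 (h 0) <= K'].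
have Gfin : finite_set Gam := near_elements_finite hG K'0.
pose A h := [set n | translates N [set h] (word om n)].
have Afin h : Gam h -> finite_set (A h).
  move=> [hGG _]; apply: contrapT => Ainf; apply: no; exists h => //.
  apply: sub_infinite_set (infinite_setD Ainf (finite_set1 0%N)) => n [An n0].
  by split => //; rewrite lt0n; apply/eqP.
have fin : finite_set (\bigcup_(h in Gam) ((fun n => word om n \o inv_map h) @` A h)).
  by apply: bigcup_finite => // h /Afin; exact: finite_image.
apply: sub_finite_set fin => f [fN [y [xy [yD fy]]]].
have fD := G_orbit (NG fN).
have [_ [n ny]] := near om x omS omx y xy.
have fw : sinh2 (f 0) (word om n 0) <= K'.
  apply: (sinh2_triangle_le fD yD (word_Disc om n Disc0)).
    exact: hdist_lt_sinh2 fD yD fy.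
  by rewrite sinh2C.
have [h hGam fh] := word_translate fN fw.
have [_ hK hVK] := schottky_group_inv hG hGam.1.
exists h => //; exists n; first by exists f => //; exists h.
by rewrite -fh; apply/funext => z /=; rewrite hVK.
Qed.

Lemma Lambda_r_sub : Lambda_r ctr rad g N `<=` radial_limit_set N.
Proof.
move=> x [om [omS /coded_in_cylinders omx [h hGG inf]]].
split; first exact: radial_coded_limit inf.
have [K K0 near] := words_near_ray.
have [hVG hK hVK] := schottky_group_inv hG hGG.
have S0 := sinh2_ge0 (G_orbit hVG) Disc0.
set S := sinh2 _ _ in S0.
have [c c0 cP] := @sinh2_le_hdist R m _ (triangle_bound_ge0 S0 K0).
exists c => //.
set A := [set n | _] in inf.
have Ainj : {in A &, injective (fun n => word om n \o inv_map h)}.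
  move=> i j _ _ ij; apply: (word_inj omS); apply/funext => y.
  by have := congr1 (fun f => f (h y)) ij; rewrite /= hK.
apply: (@sub_infinite_set _ ((fun n => word om n \o inv_map h) @` A)); last first.
  by rewrite (eq_finite_set (inj_card_eq Ainj)).
move=> _ [n [_ [f fN [_ -> fh]]] <-].
have fE : f = word om n \o inv_map h.
  by rewrite -fh; apply/funext => y /=; rewrite hVK.
rewrite -fE; split => //.
have [y [xy yD ny]] := near om x omS omx n.
exists y; split => //; split => //; apply: cP => //; first exact: G_orbit (NG fN).
apply: (sinh2_triangle_le (G_orbit (NG fN)) (word_Disc om n Disc0) yD _ ny).
rewrite fE /= sinh2_moebius; [exact: lexx|exact: word_moebius|exact: (G_orbit hVG)|exact: Disc0].
Qed.

Lemma uniformly_radial_limit_set_sub :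
  uniformly_radial_limit_set N `<=` Lambda_ur ctr rad g N.
Proof.
move=> x [xlim [c c0 cover]]; have [om omS omx] := limit_set_coded xlim.
have [K K0 near] := words_near_ray.
pose K' := triangle_bound (expR c) K.
have K'0 : 0 <= K' by exact: triangle_bound_ge0 (expR_ge0 c) K0.
exists om; split => //; first exact: in_cylinders_coded.
exists [set h | G h /\ sinh2 0 (h 0) <= K']; split.
- by move=> h [].
- exact: (near_elements_finite hG K'0).
move=> n _; have [y [xy yD ny]] := near om x omS omx n.
have [f fN [_ fy]] := cover y xy.
have fD := G_orbit (NG fN).
have fw : sinh2 (f 0) (word om n 0) <= K'.
  apply: (sinh2_triangle_le fD yD (word_Disc om n Disc0)).
    exact: hdist_lt_sinh2 fD yD fy.
  by rewrite sinh2C.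
by have [h hGam fh] := word_translate fN fw; exists f => //; exists h.
Qed.

(** Pigeonhole over the finite set of translating elements. *)
Lemma Lambda_ur_sub_r : Lambda_ur ctr rad g N `<=` Lambda_r ctr rad g N.
Proof.
move=> x [om [omS omx [Gam [GamG Gfin cover]]]].
exists om; split => //; apply: contrapT => no.
have fin : finite_set (\bigcup_(h in Gam)
    [set n | (0 < n)%N /\ translates N [set h] (word om n)]).
  apply: bigcup_finite => // h hGam; apply: contrapT => inf.
  by apply: no; exists h => //; exact: GamG.
apply: infinite_nat; apply: (@sub_finite_set _ _ ([set 0%N] `|` _)); last first.
  by rewrite finite_setU; split; [exact: finite_set1|exact: fin].
move=> n _; case: n => [|n]; first by left.
right; have [f fN [h hGam fh]] := cover n.+1 isT.
by exists h => //; split => //; exists f => //; exists h.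
Qed.

Lemma Lambda_ur_sub :
  Lambda_ur ctr rad g N `<=` uniformly_radial_limit_set N.
Proof.
move=> x xur; split; first by have [] := Lambda_r_sub (Lambda_ur_sub_r xur).
have [om [omS /coded_in_cylinders omx [Gam [GamG Gfin cover]]]] := xur.
have [K K0 near] := ray_near_words.
have [M M0 GamM] := finite_set_ubound (fun h => sinh2 0 (h 0)) Gfin.
have [c c0 cP] := @sinh2_le_hdist R m _ (triangle_bound_ge0 M0 K0).
exists c => // y xy; have [yD [n ny]] := near om x omS omx y xy.
suff [f fN fw] : exists2 f, N f & sinh2 (f 0) (word om n 0) <= M.
  exists f => //; split => //; apply: cP => //; first exact: G_orbit (NG fN).
  exact: sinh2_triangle_le (G_orbit (NG fN)) (word_Disc om n Disc0) yD fw ny.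
case: n {ny} => [|n].
  have [Nid _ _] := N1; exists id => //.
  by rewrite /sinh2 subrr dot0l mul0r.
have [f fN [h hGam fh]] := cover n.+1 isT; exists f => //.
rewrite -fh /= sinh2_moebius; first exact: GamM.
- exact: (schottky_group_moebius hG (NG fN)).
- exact: Disc0.
- exact: (G_orbit (GamG _ hGam)).
Qed.

End Subgroup.

End Coding.

Theorem proposition5p6 (R : realType) (m d : nat) (hm : (1 <= m)%N)
    (hd : (2 <= d)%N)
    (ctr : 'I_d * bool -> 'rV[R]_m.+1) (rad : 'I_d * bool -> R)
    (g : 'I_d -> 'rV[R]_m.+1 -> 'rV[R]_m.+1)
    (hG : schottky_type ctr rad g)
    (N : set ('rV[R]_m.+1 -> 'rV[R]_m.+1))
    (hN : normal_subgroup N (schottky_group g)) (hN1 : N <> [set id]) :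
  radial_limit_set N = Lambda_r ctr rad g N /\
  uniformly_radial_limit_set N = Lambda_ur ctr rad g N.
Proof.
have [N1 NG _] := hN.
split; apply/seteqP; split.
- exact: radial_limit_set_sub.
- exact: Lambda_r_sub.
- exact: uniformly_radial_limit_set_sub.
- exact: Lambda_ur_sub.
Qed.
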